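(* Let $\mathbb{F}_q$ be a fixed finite field with $q$ odd and $q\equiv 1\pmod 4$. Then, as $g\to\infty$, $$\sum_{\substack{P \text{ monic irreducible}\\ \deg P=2g+1}}L(\tfrac12,\chi_P)^2=\frac{1}{24}\,\frac{1}{\zeta_A(2)}\,|P|(\log_q|P|)^2+O\big(|P|\log_q|P|\big),$$ where on the right-hand side $|P|=q^{2g+1}$, $\log_q|P|=2g+1$, and $\zeta_A(2)=\frac{1}{1-q^{-1}}$.
   Context: $A=\mathbb{F}_q[T]$. For nonzero $f\in A$, $|f|=q^{\deg f}$. $\zeta_A(s)=\sum_{f\in A\text{ monic}}|f|^{-s}=\frac{1}{1-q^{1-s}}$. For a monic irreducible $Q\in A$ and $a\in A$, $\left(\frac{a}{Q}\right)$ equals $0$ if $Q\mid a$, $1$ if $a$ is a nonzero square modulo $Q$, and $-1$ otherwise; for monic $f=\prod_i Q_i^{e_i}$ one sets $\left(\frac{a}{f}\right)=\prod_i\left(\frac{a}{Q_i}\right)^{e_i}$, with $\left(\frac{a}{1}\right)=1$. For a monic irreducible $P$, $\chi_P(f)=\left(\frac{P}{f}\right)$ for monic $f$. For $P$ monic irreducible of odd degree $2g+1$, $L(s,\chi_P)=\sum_{f\text{ monic}}\chi_P(f)|f|^{-s}$ ($\Re s>1$) is a polynomial in $u=q^{-s}$ of degree $2g$, and $L(\tfrac12,\chi_P)$ denotes its value at $u=q^{-1/2}$. Implied constants may depend on $q$. *)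

(* Defs.v *)
From HB Require Import structures.
From mathcomp Require Import all_boot all_order all_algebra.
From Stdlib Require Import Classical ClassicalEpsilon.
Set Implicit Arguments. Unset Strict Implicit. Unset Printing Implicit Defensive.
Import Order.TTheory GRing.Theory Num.Theory.
Local Open Scope ring_scope.

Definition pbool (P : Prop) : bool :=
  if excluded_middle_informative P then true else false.

Section FqT.
Variable F : finFieldType.

(* The monic polynomial T^n + t_{n-1} T^{n-1} + ... + t_0 of degree n;
   t ranges bijectively over all monic polynomials of degree n. *)
Definition monic_of (n : nat) (t : n.-tuple F) : {poly F} := Poly (rcons t 1).

Definition irredb (p : {poly F}) : bool := pbool (irreducible_poly p).

Definition legendre (a Q : {poly F}) : int :=
  if Q %| a then 0
  else if pbool (exists b : {poly F}, Q %| b ^+ 2 - a) then 1 else -1.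

(* Exponent of Q in f (f nonzero, Q nonconstant): #{ i in [1, deg f] : Q^i | f }. *)
Definition pval (Q f : {poly F}) : nat :=
  (\sum_(1 <= i < size f) nat_of_bool ((Q ^+ i)%R %| f)%R)%N.

(* Jacobi symbol (a/f) for f monic: product over monic irreducible Q | f
   (necessarily of degree 1 <= d <= deg f) of (a/Q)^{v_Q(f)}. *)
Definition jacobi (a f : {poly F}) : int :=
  \prod_(1 <= d < size f)
    \prod_(t : d.-tuple F | irredb (monic_of t))
       legendre a (monic_of t) ^+ pval (monic_of t) f.

Definition chi (P f : {poly F}) : int := jacobi P f.

Variable R : rcfType.

Definition qR : R := (#|F|)%:R.

(* L(1/2, chi_P) for deg P = 2g+1: value at u = q^{-1/2} of the polynomial
   sum_{n=0}^{2g} (sum_{f monic, deg f = n} chi_P(f)) u^n. *)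
Definition Lhalf (P : {poly F}) : R :=
  \sum_(n < (size P).-2.+1)
     (\sum_(t : n.-tuple F) (chi P (monic_of t))%:~R) / (Num.sqrt qR) ^+ n.

Definition zetaA2 : R := (1 - qR^-1)^-1.

Definition second_moment (g : nat) : R :=
  \sum_(t : (2 * g + 1).-tuple F | irredb (monic_of t)) (Lhalf (monic_of t)) ^+ 2.

End FqT.

(* Main.v *)
(** L(1/2, chi_P)^2 is a sum over pairs (f, h) of monic polynomials of the values chi_P(f h),
    and the functional equation of L(s, chi_P), whose sign does not matter for the square,
    reduces it to pairs with deg f + deg h <= 2 g. Since q = 1 mod 4, reciprocity gives
    chi_P(f h) = (f h / P). The pairs with f h a square yield the main term; they are counted
    by dividing f and h by their greatest common divisor. For the other pairs one needs that
    the sum of (f / P) over the primes P of degree n = 2 g + 1 is O(q^(n/2)), uniformly in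
    non-square f of degree < n. This is Weil's bound, proved by Bombieri's form of
    Stepanov's method inside F_q[T]: with R = q^g and r = q^(g+1) there is a non-zero
    polynomial G of degree q^n / 2 + O(deg f * r), of the form
    Sum_j (a_j + f^((r+1)/2) d_j) T^(j r), such that G^R vanishes modulo every prime P of
    degree n for which (f / P) has a prescribed value; hence G is divisible by all of them. *)

Require Import Defs.
From HB Require Import structures.
From mathcomp Require Import all_boot all_order all_algebra.
From mathcomp Require Import fingroup cyclic all_field zify ring lra.
Import Order.TTheory GRing.Theory Num.Theory.
Local Open Scope ring_scope.

Set Implicit Arguments.
Unset Strict Implicit.
Unset Printing Implicit Defensive.

(** * Enumeration of polynomials and Frobenius maps *)

Section Enumeration.
Variable F : finFieldType.
Local Notation q := #|F|.

(** The error term is borderline. There are (k+1) q^k pairs of total degree k, each weighted by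
    q^(-k/2), so Weil's bound leaves n q^(g+1) times a geometric series of ratio sqrt q, dominated
    by k = 2g: this is O(n q^n). The square pairs of total degree 2m number q^m times a quadratic
    polynomial in m, so their weighted sum is a cubic in n with leading coefficient (1 - 1/q)/24,
    and about q^n/n primes turn it into the main term. The functional equation is proved over the
    integers, by a Gauss sum in which the quadratic character of F composed with a linear form
    replaces the additive character; it needs n odd, so that chi_P is non-trivial on constants.
    Stepanov's method counts primes instead of points of y^2 = f: all it needs of P is Euler's
    criterion and T^(q^n) = T modulo P, and each prime accounts for n in the degree of G. It gives
    only upper bounds, for both signs; a lower bound for the number of all primes of degree n makes
    them two-sided. *)

Definition mon (n : nat) : seq {poly F} := [seq monic_of t | t : n.-tuple F].
Definition pol (n : nat) : seq {poly F} := [seq Poly t | t : n.-tuple F].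

Lemma coef_monic_of n (t : n.-tuple F) i :
  (monic_of t)`_i = if (i < n)%N then t`_i else (i == n)%:R.
Proof.
rewrite /monic_of coef_Poly nth_rcons size_tuple.
by case: ltngtP.
Qed.

Lemma monic_of_inj n : injective (@monic_of F n).
Proof.
move=> t u e; apply/val_inj/(@eq_from_nth _ 0); first by rewrite !size_tuple.
move=> i; rewrite size_tuple => hi.
by have := congr1 (fun p : {poly F} => p`_i) e; rewrite !coef_monic_of hi.
Qed.

Lemma Poly_tuple_inj n : injective (fun t : n.-tuple F => Poly t).
Proof.
move=> t u e; apply/val_inj/(@eq_from_nth _ 0); first by rewrite !size_tuple.
move=> i; rewrite size_tuple => hi.
by have := congr1 (fun p : {poly F} => p`_i) e; rewrite !coef_Poly.
Qed.

Lemma mon_uniq n : uniq (mon n).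
Proof. by rewrite map_inj_uniq ?enum_uniq //; apply: monic_of_inj. Qed.

Lemma pol_uniq n : uniq (pol n).
Proof. by rewrite map_inj_uniq ?enum_uniq //; apply: Poly_tuple_inj. Qed.

Lemma size_mon n : size (mon n) = (q ^ n)%N.
Proof. by rewrite size_map -cardE card_tuple. Qed.

Lemma size_pol n : size (pol n) = (q ^ n)%N.
Proof. by rewrite size_map -cardE card_tuple. Qed.

Lemma mem_mon n (p : {poly F}) : (p \in mon n) = (p \is monic) && (size p == n.+1).
Proof.
apply/mapP/andP => [[t _ ->]|[pm /eqP sp]].
  have sz : size (monic_of t) = n.+1.
    apply/eqP; rewrite eqn_leq; apply/andP; split.
      apply/leq_sizeP => j hj; rewrite coef_monic_of ltnNge ltnW //=.
      by rewrite gtn_eqF.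
    rewrite ltnNge; apply/negP => /leq_sizeP /(_ n (leqnn n)).
    by rewrite coef_monic_of ltnn eqxx => /eqP; rewrite oner_eq0.
  split; last by rewrite sz.
  by rewrite monicE lead_coefE sz coef_monic_of ltnn eqxx.
exists [tuple p`_i | i < n]; first by rewrite mem_enum.
apply/polyP => i; rewrite coef_monic_of; case: ltngtP => h.
- by rewrite -[i]/(nat_of_ord (Ordinal h)) nth_mktuple.
- by rewrite nth_default // sp.
- by rewrite h; move/monicP: pm; rewrite lead_coefE sp.
Qed.

Lemma mem_pol n (p : {poly F}) : (p \in pol n) = (size p <= n)%N.
Proof.
apply/mapP/idP => [[t _ ->]|sp].
  by apply: leq_trans (size_Poly _) _; rewrite size_tuple.
exists [tuple p`_i | i < n]; first by rewrite mem_enum.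
apply/polyP => i; rewrite coef_Poly; case: (ltnP i n) => h.
  by rewrite -[i]/(nat_of_ord (Ordinal h)) nth_mktuple.
by rewrite nth_default ?(leq_trans sp) // nth_default // size_tuple.
Qed.

Lemma sum_mon (V : nmodType) n (P : pred {poly F}) (G : {poly F} -> V) :
  \sum_(t : n.-tuple F | P (monic_of t)) G (monic_of t) = \sum_(p <- mon n | P p) G p.
Proof. by rewrite big_map big_enum_cond. Qed.

Lemma prod_mon (V : comPzSemiRingType) n (P : pred {poly F}) (G : {poly F} -> V) :
  \prod_(t : n.-tuple F | P (monic_of t)) G (monic_of t) = \prod_(p <- mon n | P p) G p.
Proof. by rewrite big_map big_enum_cond. Qed.

Lemma monP n p : p \in mon n -> [/\ p \is monic, size p = n.+1 & p != 0].
Proof. by rewrite mem_mon => /andP[pm /eqP sp]; split=> //; rewrite monic_neq0. Qed.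

End Enumeration.

Lemma big_uniq_bij (V : nmodType) (I J : eqType) (r : seq I) (s : seq J)
    (f : I -> J) (G : J -> V) :
  uniq r -> uniq s -> {in r &, injective f} ->
  (forall x, x \in r -> f x \in s) ->
  (forall y, y \in s -> exists2 x, x \in r & y = f x) ->
  \sum_(y <- s) G y = \sum_(x <- r) G (f x).
Proof.
move=> ur us fi fr fs; rewrite -[RHS](big_map f predT G).
apply: perm_big; apply: uniq_perm; rewrite ?map_inj_in_uniq // => y.
apply/idP/mapP => [/fs//|[x xr ->]]; exact: fr.
Qed.

Lemma pboolP (P : Prop) : reflect P (pbool P).
Proof.
by rewrite /pbool; case: ClassicalEpsilon.excluded_middle_informative => h; constructor.
Qed.

Section Frobenius.
Variable F : finFieldType.
Local Notation q := #|F|.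

Lemma card_gt1 : (1 < q)%N. Proof. exact: finNzRing_gt1. Qed.

Lemma expf_cardX k (x : F) : x ^+ (q ^ k) = x.
Proof. by elim: k => [|k IH]; rewrite ?expr1 // expnS exprM expf_card. Qed.

Lemma card_prime_power : exists p e, [/\ prime p, p \in [pchar F], (0 < e)%N & q = (p ^ e)%N].
Proof.
have [p pr chp] := finPcharP F; have qE := card_pprimeChar chp.
exists p, (logn p #|pPrimeCharType chp|); split=> //.
by rewrite lt0n; apply: contraTneq card_gt1 => e0; rewrite [#|F|]qE e0.
Qed.

(* The ring L receives F through i, so that L has the characteristic of F. *)
Lemma frobeniusD (L : comNzRingType) (i : {rmorphism F -> L}) k (x y : L) :
  (x + y) ^+ (q ^ k) = x ^+ (q ^ k) + y ^+ (q ^ k).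
Proof.
have [p [e [pr chp _ qE]]] := card_prime_power.
have chL : p \in [pchar L] := rmorph_pchar i chp.
apply: (@exprDn_pchar _ x y (q ^ k)).
by rewrite qE -expnM pnatX pnatE // chL.
Qed.

Lemma frobenius_sum (L : comNzRingType) (i : {rmorphism F -> L}) k
    (I : Type) (r : seq I) (G : I -> L) :
  (\sum_(j <- r) G j) ^+ (q ^ k) = \sum_(j <- r) G j ^+ (q ^ k).
Proof.
elim: r => [|j r IH]; first by rewrite !big_nil expr0n gtn_eqF // expn_gt0 (ltnW card_gt1).
by rewrite !big_cons (frobeniusD i) IH.
Qed.

Lemma frobeniusB (L : comNzRingType) (i : {rmorphism F -> L}) k (x y : L) :
  (x - y) ^+ (q ^ k) = x ^+ (q ^ k) - y ^+ (q ^ k).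
Proof. by apply/eqP; rewrite eq_sym subr_eq -(frobeniusD i) subrK. Qed.

Lemma frobenius_horner (L : comNzRingType) (i : {rmorphism F -> L}) k (p : {poly F}) (x : L) :
  (map_poly i p).[x] ^+ (q ^ k) = (map_poly i p).[x ^+ (q ^ k)].
Proof.
rewrite !horner_coef (frobenius_sum i); apply: eq_bigr => j _.
by rewrite coef_map exprMn -rmorphXn /= expf_cardX exprAC.
Qed.

End Frobenius.

(** * Monic irreducible factors *)

Section Irreducible.
Variable F : finFieldType.
Local Notation q := #|F|.
Implicit Types P : {poly F}.

Lemma monic_size_le1 (f : {poly F}) : f \is monic -> (size f <= 1)%N -> f = 1.
Proof.
move=> fm s1; apply/eqP; rewrite -eqp_monic ?monic1 // -size_poly_eq1.
by rewrite eqn_leq s1 size_poly_gt0 monic_neq0.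
Qed.

Lemma irreducible_factor (f : {poly F}) :
  (1 < size f)%N -> exists P, [/\ P \is monic, irreducible_poly P & P %| f].
Proof.
have [m] := ubnP (size f); elim: m f => // m IH f hm f1.
case: (ClassicalEpsilon.excluded_middle_informative (irreducible_poly f)) => [irr|nirr].
  have f0 := irredp_neq0 irr.
  have lc0 : lead_coef f != 0 by rewrite lead_coef_eq0.
  have e : (lead_coef f)^-1 *: f %= f by rewrite eqp_scale ?invr_eq0.
  exists ((lead_coef f)^-1 *: f); split.
  - by rewrite monicE lead_coefZ mulVf.
  - split; first by rewrite (eqp_size e).
    move=> d d1; rewrite (eqp_dvdr _ e) => dd.
    by apply: eqp_trans (irr.2 d d1 dd) _; rewrite eqp_sym.
  - by rewrite (eqp_dvdl _ e).
have [d [d1 df ndf]] : exists d : {poly F}, [/\ size d != 1%N, d %| f & ~~ (d %= f)].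
  case: (ClassicalEpsilon.excluded_middle_informative
     (exists d : {poly F}, [/\ size d != 1%N, d %| f & ~~ (d %= f)])) => // nex.
  case: nirr; split=> // d d1 df; apply/negPn/negP => ndf.
  by apply: nex; exists d.
have f0 : f != 0 by rewrite -size_poly_gt0 ltnW.
have d0 : d != 0 by apply: contraNneq f0 => d0; rewrite d0 dvd0p in df.
have sd : (size d < size f)%N.
  rewrite ltn_neqAle dvdp_leq // andbT.
  by apply: contra ndf => /eqP e; rewrite -dvdp_size_eqp // e.
have [|P [Pm Pi Pd]] := IH d (leq_trans sd hm).
  by rewrite ltn_neqAle eq_sym d1 size_poly_gt0.
by exists P; split=> //; apply: dvdp_trans Pd df.
Qed.

End Irreducible.

(** * Residue fields and Euler's criterion *)

Section ResidueField.
Variable F : finFieldType.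
Local Notation q := #|F|.
Implicit Types P : {poly F}.

Lemma residue_field P : P \is monic -> irreducible_poly P ->
  exists (K : finFieldType) (pi : {rmorphism {poly F} -> K}),
    [/\ forall a, (pi a == 0) = (P %| a),
        #|K| = (q ^ (size P).-1)%N
      & forall y, exists a, pi a = y].
Proof.
move=> Pm Pi; pose hI : monic_irreducible_poly P := (Pi, Pm).
have PE := mk_monicE hI.
pose K : finFieldType := {poly %/ P with hI}.
pose pi : {rmorphism {poly F} -> K} := (in_qpoly P : {rmorphism {poly F} -> {poly %/ P}}).
exists K, pi; split.
- move=> a; rewrite -val_eqE /= PE -Pdiv.IdomainMonic.modpE //; exact: hI.2.
- exact: card_qfpoly.
- move=> y; exists (val (y : {poly %/ P})); apply: val_inj.
  by rewrite /= Pdiv.CommonRing.rmodp_small // size_mk_monic.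
Qed.

(** Taken at p = P, this makes [pi 'X] a root of P in its residue field. *)
Lemma horner_residue (K : finFieldType) (pi : {rmorphism {poly F} -> K}) (p : {poly F}) :
  (map_poly (pi \o polyC) p).[pi 'X] = pi p.
Proof.
rewrite -[p in RHS]coefK poly_def rmorph_sum /= horner_coef size_map_poly.
by apply: eq_bigr => j _; rewrite coef_map /= -mul_polyC rmorphM rmorphXn.
Qed.

Lemma size_XqX (L : nzRingType) n : (0 < n)%N -> size ('X^(q ^ n) - 'X : {poly L}) = (q ^ n).+1.
Proof.
move=> n0; rewrite size_polyDl ?size_polyXn // size_polyN size_polyX ltnS.
by apply: leq_trans (card_gt1 F) _; rewrite -{1}(expn1 q) leq_exp2l ?card_gt1.
Qed.

Lemma dvdp_mul_irr P a b : irreducible_poly P -> P %| a * b -> (P %| a) || (P %| b).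
Proof.
move=> Pi; case: (boolP (P %| a)) => //= na; rewrite Gauss_dvdpr //.
by rewrite irreducible_poly_coprime.
Qed.

Lemma monic_irr_dvdp P P' : P \is monic -> P' \is monic ->
  irreducible_poly P -> irreducible_poly P' -> P %| P' -> P = P'.
Proof.
move=> Pm Pm' Pi Pi' d; apply/eqP; rewrite -eqp_monic //.
by apply: Pi'.2 => //; case: Pi => h _; rewrite neq_ltn h orbT.
Qed.

Lemma monic_irr_coprime P P' : P \is monic -> P' \is monic ->
  irreducible_poly P -> irreducible_poly P' -> P != P' -> coprimep P P'.
Proof.
move=> Pm Pm' Pi Pi' ne; rewrite irreducible_poly_coprime //.
by apply: contra ne => /monic_irr_dvdp -> //.
Qed.

(* The roots of X^(q^k) - X in a field L number at most q^k, whereas the values at alpha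
   of the polynomials of degree < deg P form q^(deg P) such roots. *)
Lemma frobenius_orbit (L : fieldType) (i : {rmorphism F -> L}) P (alpha : L) k :
  P \is monic -> irreducible_poly P -> root (map_poly i P) alpha ->
  (0 < k)%N -> alpha ^+ (q ^ k) = alpha -> ((size P).-1 <= k)%N.
Proof.
move=> Pm Pi ra k0 ak; set n := (size P).-1.
pose ev (p : {poly F}) := (map_poly i p).[alpha].
have sP : size P = n.+1 by rewrite prednK // ltnW // Pi.1.
pose rs := [seq ev p | p <- pol F n].
have urs : uniq rs.
  rewrite map_inj_in_uniq ?pol_uniq // => a b; rewrite !mem_pol => sa sb e.
  apply/eqP; rewrite -subr_eq0; apply/negPn/negP => nz.
  have sz : (size (a - b)%R < size P)%N.
    rewrite sP ltnS (leq_trans (size_polyD _ _)) // geq_max sa size_polyN sb //.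
  have cop : coprimep P (a - b).
    rewrite irreducible_poly_coprime //; apply/negP => /(dvdp_leq nz).
    by rewrite leqNgt sz.
  have := coprimep_root (p := map_poly i P) (q := map_poly i (a - b)) (x := alpha).
  rewrite coprimep_map cop => /(_ isT ra) /negP; apply.
  by rewrite rmorphB /= hornerD hornerN -/(ev a) -/(ev b) e subrr.
have sizeX := @size_XqX L k k0.
have nzX : 'X^(q ^ k) - 'X != 0 :> {poly L} by rewrite -size_poly_eq0 sizeX.
have := max_poly_roots nzX _ urs; rewrite sizeX size_map size_pol ltnS.
rewrite leq_exp2l ?card_gt1 //; apply; apply/allP => y /mapP[p _ ->].
by rewrite rootE !hornerE /ev frobenius_horner ak subrr.
Qed.

(** The units form a cyclic group of order 2h with h = [#|K|./2]. If w generates it and y = w^k,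
    then w^(k h) = 1 forces 2h to divide k h, so k is even. *)
Lemma fin_square (K : finFieldType) (y : K) :
  odd #|K| -> y != 0 -> y ^+ #|K|./2 = 1 -> exists z, z ^+ 2 = y.
Proof.
move=> oK y0; have : y \is a GRing.unit by rewrite unitfE.
move=> yu; pose u : {unit K} := FinRing.unit K yu.
have /cyclicP[w wE] := field_unit_group_cyclic [set: {unit K}]%G.
have /cycleP[k uk] : u \in <[w]>%g by rewrite -wE inE.
move=> h1; have : (w ^+ (k * #|K|./2) = 1)%g.
  apply: val_inj; rewrite expgM -uk FinRing.val_unitX /= h1 //.
move/eqP; rewrite -order_dvdn -[#[w]%g]/(#|<[w]>%g|) -wE card_finField_unit.
have -> : #|K|.-1 = (2 * #|K|./2)%N by rewrite mul2n -[X in X.-1]odd_double_half oK.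
rewrite dvdn_pmul2r ?half_gt0 ?card_gt1 // => /dvdnP[j kE].
exists (val (w ^+ j)%g).
by rewrite -FinRing.val_unitX -expgM -kE -uk.
Qed.

Lemma legendre_euler P a : odd q -> P \is monic -> irreducible_poly P ->
  P %| a ^+ (q ^ (size P).-1)./2 - (legendre a P)%:~R.
Proof.
move=> oq Pm Pi; have [K [pi [pi0 cK pis]]] := residue_field Pm Pi.
rewrite -pi0 rmorphB rmorphXn /= rmorph_int -cK.
have oK : odd #|K| by rewrite cK oddX oq orbT.
have K1 := card_gt1 K.
have h0 : (0 < #|K|./2)%N by rewrite half_gt0.
rewrite /legendre -pi0; case: (eqVneq (pi a) 0) => [->|nz]; first by rewrite expr0n gtn_eqF // subrr.
have cE : (#|K|./2 * 2).+1 = #|K| by rewrite muln2 -[RHS]odd_double_half oK.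
have sqr1 (y : K) : y != 0 -> (y ^+ #|K|./2) ^+ 2 = 1.
  move=> y0; apply: (mulfI y0); rewrite -exprM -exprS cE expf_card mulr1 //.
have pm1 (y : K) : y != 0 -> y ^+ #|K|./2 = 1 \/ y ^+ #|K|./2 = -1.
  by move/sqr1/eqP; rewrite sqrf_eq1 => /orP[]/eqP; [left|right].
case: pboolP => [[b]|nsq].
  rewrite -pi0 rmorphB rmorphXn /= subr_eq0 => /eqP e.
  rewrite -e -exprM mulnC -[X in X - _]/(_ ^+ _) exprM sqr1 ?subrr //.
  by apply: contraNneq nz => b0; rewrite -e b0 expr0n.
case: (pm1 _ nz) => h; last by rewrite h rmorphN1 subrr.
have [z zE] := fin_square oK nz h.
by case: nsq; have [b bE] := pis z; exists b; rewrite -pi0 rmorphB rmorphXn /= bE zE subrr.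
Qed.
End ResidueField.

(** * Quadratic reciprocity *)

Section Legendre.
Variable F : finFieldType.
Local Notation q := #|F|.
Implicit Types P : {poly F}.

Lemma legendre_val a P : [|| legendre a P == 0, legendre a P == 1 | legendre a P == -1].
Proof. by rewrite /legendre; case: ifP => // _; case: ifP. Qed.

Lemma two_neq0 (L : comNzRingType) (i : {rmorphism F -> L}) : odd q -> (2%:R : L) != 0.
Proof.
move=> oq; apply/negP => /eqP e.
have pL : 2%N \in [pchar L] by rewrite inE /= e eqxx.
have pF : 2%N \in [pchar F] by rewrite -(fmorph_pchar i).
have := card_pprimeChar pF; rewrite -[#|_|]/q => h.
move: oq; rewrite h oddX /= orbF => /eqP k0; rewrite k0 expn0 in h.
by have := card_gt1 F; rewrite h.
Qed.

(** In odd characteristic 0, 1 and -1 stay distinct, so identities between symbols may be checked in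
    a residue field. *)
Lemma sign_inj (L : comNzRingType) (i : {rmorphism F -> L}) (x y : int) : odd q ->
  [|| x == 0, x == 1 | x == -1] -> [|| y == 0, y == 1 | y == -1] ->
  (x%:~R : L) = y%:~R -> x = y.
Proof.
move=> oq; have t0 := two_neq0 i oq; have o0 := oner_neq0 L.
have t1 : (1 : L) != -1 by rewrite -subr_eq0 opprK.
have [z1 z2] : ((1 : L) == 0) = false /\ ((-1 : L) == 0) = false by rewrite oppr_eq0 (negPf o0).
by move=> /or3P[]/eqP-> /or3P[]/eqP-> //; rewrite ?rmorphN1 ?mulr0z ?mulr1z => /eqP;
  rewrite ?z1 ?z2 1?eq_sym ?z1 ?z2 ?(negPf t1) // eq_sym (negPf t1).
Qed.

Hypothesis oq : odd q.

Lemma legendre_unique P a (e : int) : P \is monic -> irreducible_poly P ->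
  [|| e == 0, e == 1 | e == -1] -> P %| a ^+ (q ^ (size P).-1)./2 - e%:~R -> legendre a P = e.
Proof.
move=> Pm Pi he; have [K [pi [pi0 cK _]]] := residue_field Pm Pi.
have := legendre_euler a oq Pm Pi; rewrite -!pi0 !rmorphB !rmorph_int !subr_eq0 => /eqP -> /eqP.
exact: (sign_inj (pi \o polyC : {rmorphism F -> K}) oq (legendre_val a P) he).
Qed.

Lemma legendreM P a b : P \is monic -> irreducible_poly P ->
  legendre (a * b) P = legendre a P * legendre b P.
Proof.
move=> Pm Pi; apply: legendre_unique => //.
  by have := legendre_val a P; have := legendre_val b P => /or3P[]/eqP-> /or3P[]/eqP->.
have [K [pi [pi0 cK _]]] := residue_field Pm Pi.
have := legendre_euler a oq Pm Pi; have := legendre_euler b oq Pm Pi.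
rewrite -!pi0 !rmorphB !rmorph_int !subr_eq0 => /eqP eb /eqP ea.
by rewrite exprMn rmorphM /= ea eb intrM.
Qed.

Lemma legendre_mod P a b : P %| a - b -> legendre a P = legendre b P.
Proof.
move=> d; rewrite /legendre; have -> : (P %| a) = (P %| b).
  by rewrite -{1}(subrK b a) dvdp_addr.
have dE c : (P %| c ^+ 2 - a) = (P %| c ^+ 2 - b).
  have -> : c ^+ 2 - b = (a - b) + (c ^+ 2 - a) by rewrite [RHS]addrC subrKA.
  by rewrite (dvdp_addr _ d).
suff -> : pbool (exists c, P %| c ^+ 2 - a) = pbool (exists c, P %| c ^+ 2 - b) by [].
apply/idP/idP => /pboolP[c hc].
  by apply/pboolP; exists c; rewrite -dE.
by apply/pboolP; exists c; rewrite dE.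
Qed.

Lemma legendre_sqr P a : irreducible_poly P -> ~~ (P %| a) -> legendre (a ^+ 2) P = 1.
Proof.
move=> Pi na; rewrite /legendre ifF; last first.
  by apply/negP; rewrite expr2 => /(dvdp_mul_irr Pi); rewrite orbb; apply/negP.
by rewrite ifT //; apply/pboolP; exists a; rewrite subrr dvdp0.
Qed.

Lemma legendre_eq0 P a : (legendre a P == 0) = (P %| a).
Proof. by rewrite /legendre; case: ifP => // _; case: ifP. Qed.

Lemma frobenius_factor (L : fieldType) (i : {rmorphism F -> L}) P (alpha : L) :
  P \is monic -> irreducible_poly P -> root (map_poly i P) alpha ->
  map_poly i P = \prod_(k < (size P).-1) ('X - (alpha ^+ (q ^ k))%:P).
Proof.
move=> Pm Pi ra; pose rs := [seq alpha ^+ (q ^ k) | k <- iota 0 (size P).-1].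
have sP : size P = (size P).-1.+1 by rewrite prednK // ltnW // Pi.1.
have frob_inj k : injective (fun x : L => x ^+ (q ^ k)).
  move=> x y /= /eqP; rewrite -subr_eq0 -(frobeniusB i) expf_eq0 => /andP[_].
  by rewrite subr_eq0 => /eqP.
have urs : uniq rs.
  rewrite map_inj_in_uniq ?iota_uniq // => k l.
  rewrite !mem_iota /= add0n => hk hl.
  wlog kl : k l hk hl / (k <= l)%N.
    by move=> W; case: (leqP k l) => [/W|/ltnW h e]; [exact|rewrite (W l k)].
  rewrite -(subnK kl) expnD exprM => /frob_inj e.
  case: (posnP (l - k)) => [z|pos]; first by rewrite z add0n.
  have := frobenius_orbit Pm Pi ra pos (esym e).
  by rewrite leqNgt (leq_ltn_trans (leq_subr _ _)).
have ars : all (root (map_poly i P)) rs.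
  apply/allP => y /mapP[k _ ->]; rewrite rootE -frobenius_horner.
  by move: ra; rewrite rootE => /eqP->; rewrite expr0n gtn_eqF // expn_gt0 (ltnW (card_gt1 F)).
have := all_roots_prod_XsubC _ ars; rewrite uniq_rootsE urs size_map size_iota size_map_poly -sP.
move=> /(_ erefl isT) ->; rewrite lead_coef_map (monicP Pm) rmorph1 scale1r.
by rewrite big_map -[X in iota 0 X]subn0 -/(index_iota _ _) big_mkord.
Qed.

(** For odd q, [(q ^ m)./2] is (q^m - 1)/2. This splits Euler's exponent into a norm, which is a
    product of Frobenius powers, and the exponent (q-1)/2 of F itself. *)
Lemma half_expn m : (q ^ m)./2 = ((\sum_(l < m) q ^ l) * q./2)%N.
Proof.
elim: m => [|m IH]; first by rewrite big_ord0.
rewrite big_ord_recr /= mulnDl -IH expnS.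
have := odd_double_half q; have := odd_double_half (q ^ m); rewrite oddX oq orbT /=.
move=> e' e; rewrite -[X in X./2](_ : true + ((q ^ m)./2 + q ^ m * q./2).*2 = _)%N ?half_bit_double //.
by move: (q ^ m)%N (q ^ m)./2 q q./2 e e' => Q h x y <- /= <-; nia.
Qed.

(** Euler's criterion gives P(beta)^((q^m - 1)/2) with m = deg P'. By [half_expn] this is the
    (q-1)/2-th power of the norm of P(beta), a resultant, which is symmetric in P and P' up to
    sign. *)
Lemma norm_eval (L : fieldType) (i : {rmorphism F -> L}) P P' (alpha beta : L) :
  P \is monic -> irreducible_poly P -> P' \is monic -> irreducible_poly P' ->
  root (map_poly i P) alpha -> root (map_poly i P') beta ->
  (legendre P P')%:~R = (\prod_(l < (size P').-1) \prod_(k < (size P).-1)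
     (beta ^+ (q ^ l) - alpha ^+ (q ^ k))) ^+ (q./2) :> L.
Proof.
move=> Pm Pi Pm' Pi' ra rb.
have /dvdpP[h /eqP] := legendre_euler P oq Pm' Pi'; rewrite subr_eq => /eqP.
move=> /(congr1 (fun p => (map_poly i p).[beta])).
rewrite !rmorphD !rmorphM /= rmorphXn /= hornerD hornerM (rootP rb) mulr0 add0r.
have hz z : (z%:~R : {poly L}).[beta] = z%:~R by rewrite -(rmorph_int polyC) hornerC.
rewrite !rmorph_int hz => <-.
rewrite horner_exp half_expn exprM; congr (_ ^+ _).
rewrite -prodrXr; apply: eq_bigr => l _.
rewrite frobenius_horner (frobenius_factor Pm Pi ra) horner_prod.
by apply: eq_bigr => k _; rewrite !hornerE.
Qed.

(** The residue field K of P contains a root of P. As P' need not be irreducible over K, the second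
    extension is the residue field of one of its factors there. *)
Lemma common_roots P P' : P \is monic -> irreducible_poly P -> (1 < size P')%N ->
  exists (L : finFieldType) (i : {rmorphism F -> L}) (alpha beta : L),
    root (map_poly i P) alpha /\ root (map_poly i P') beta.
Proof.
move=> Pm Pi s'; have [K [pi [pi0 _ _]]] := residue_field Pm Pi.
pose i0 : {rmorphism F -> K} := pi \o polyC.
have [|Q [Qm Qi Qd]] := @irreducible_factor K (map_poly i0 P'); first by rewrite size_map_poly.
have [L [rho [rho0 _ _]]] := residue_field Qm Qi.
pose i1 : {rmorphism K -> L} := rho \o polyC.
exists L, (i1 \o i0 : {rmorphism F -> L}), (i1 (pi 'X)), (rho 'X).
have mc p : map_poly (i1 \o i0) p = map_poly i1 (map_poly i0 p) by rewrite map_poly_comp.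
split; rewrite rootE mc.
  by rewrite horner_map (horner_residue pi P : (map_poly i0 P).[_] = _) fmorph_eq0 pi0.
by rewrite horner_residue rho0.
Qed.

Lemma quadratic_reciprocity P P' : (q %% 4 = 1)%N ->
  P \is monic -> irreducible_poly P -> P' \is monic -> irreducible_poly P' ->
  legendre P P' = legendre P' P.
Proof.
move=> q4 Pm Pi Pm' Pi'; have [L [i [alpha [beta [ra rb]]]]] := common_roots Pm Pi Pi'.1.
apply: (sign_inj i oq (legendre_val _ _) (legendre_val _ _)).
rewrite (norm_eval Pm Pi Pm' Pi' ra rb) (norm_eval Pm' Pi' Pm Pi rb ra).
(* For q = 1 mod 4 the exponent (q-1)/2 is even, so exchanging the roots, which negates every
   factor, has no effect. *)
have -> : q./2 = (2 * (q %/ 4))%N by lia.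
rewrite !exprM exchange_big /=; congr (_ ^+ _).
rewrite -!prodrXl; apply: eq_bigr => k _; rewrite -!prodrXl; apply: eq_bigr => l _.
by rewrite -sqrrN opprB.
Qed.

End Legendre.

(** * The Jacobi symbol *)

Section Jacobi.
Variable F : finFieldType.
Local Notation q := #|F|.
Implicit Types P Q f : {poly F}.

Lemma irredbP P : reflect (irreducible_poly P) (irredb P).
Proof. exact: pboolP. Qed.

Lemma size_exp_gt Q i : (1 < size Q)%N -> (i < size (Q ^+ i))%N.
Proof.
move=> s1; have Q0 : Q != 0 by rewrite -size_poly_gt0 ltnW.
have := size_exp Q i; have : (0 < size (Q ^+ i))%N by rewrite size_poly_gt0 expf_neq0.
by case: (size Q) s1 => [|[|s]] // _; case: (size _) => //= n _ ->; rewrite ltnS leq_pmull.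
Qed.

(** Since deg Q^i >= i, larger exponents contribute nothing. A common range makes [pval Q f] and
    [pval Q (Q * f)] comparable. *)
Lemma pval_widen Q f N : (1 < size Q)%N -> f != 0 -> (size f <= N)%N ->
  pval Q f = (\sum_(1 <= i < N) (Q ^+ i %| f)%R)%N.
Proof.
move=> s1 f0 fN; have f1 : (1 <= size f)%N by rewrite size_poly_gt0.
rewrite (big_cat_nat f1 fN) /= [X in (_ + X)%N]big_nat_cond [X in (_ + X)%N]big1 ?addn0 // => i.
case/andP=> /andP[hi _] _; case: (boolP (_ %| _)) => // /(dvdp_leq f0).
by rewrite leqNgt (leq_ltn_trans hi) // size_exp_gt.
Qed.

Lemma pval_large Q f : (size f < size Q)%N -> f != 0 -> pval Q f = 0%N.
Proof.
move=> sQ f0; rewrite /pval big_nat_cond big1 // => i /andP[/andP[i1 _] _].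
case: (boolP (_ %| _)) => // /(dvdp_leq f0).
rewrite leqNgt (leq_trans sQ) // dvdp_leq ?dvdp_exp //.
by rewrite expf_neq0 // -size_poly_gt0 (leq_ltn_trans _ sQ).
Qed.

Lemma pval_mul_irr Q f : irreducible_poly Q -> f != 0 -> pval Q (Q * f) = (pval Q f).+1.
Proof.
move=> Qi f0; have Q0 := irredp_neq0 Qi; have s1 := Qi.1.
have sf : (size f <= size (Q * f)%R)%N by rewrite dvdp_leq ?dvdp_mull ?mulf_neq0.
have s2 : (1 < size (Q * f)%R)%N.
  by apply: leq_trans s1 _; rewrite dvdp_leq ?dvdp_mulr ?mulf_neq0.
rewrite (@pval_widen Q (Q * f) (size (Q * f)%R).+1) ?mulf_neq0 // (pval_widen s1 f0 sf).
rewrite big_nat_recl 1?ltnW // expr1 dvdp_mulr // add1n; congr _.+1.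
by apply: eq_bigr => i _; rewrite exprS dvdp_mul2l.
Qed.

Lemma pval_mul_other Q Q' f : Q \is monic -> Q' \is monic -> irreducible_poly Q ->
  irreducible_poly Q' -> Q != Q' -> f != 0 -> pval Q' (Q * f) = pval Q' f.
Proof.
move=> Qm Qm' Qi Qi' ne f0; have Q0 := irredp_neq0 Qi; have s1 := Qi'.1.
have sf : (size f <= size (Q * f)%R)%N by rewrite dvdp_leq ?dvdp_mull ?mulf_neq0.
rewrite (pval_widen s1 f0 sf); apply: eq_bigr => i _; rewrite Gauss_dvdpr //.
by apply: coprimep_expl; rewrite coprimep_sym monic_irr_coprime.
Qed.

Lemma jacobi_widen (a : {poly F}) f N : f != 0 -> (size f <= N)%N ->
  jacobi a f =
    \prod_(1 <= d < N) \prod_(Q <- mon F d | irredb Q) legendre a Q ^+ pval Q f.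
Proof.
move=> f0 fN; have f1 : (1 <= size f)%N by rewrite size_poly_gt0.
rewrite (big_cat_nat f1 fN) /= [X in _ * X]big_nat_cond [X in _ * X]big1 ?mulr1.
  by apply: eq_bigr => d _; rewrite (prod_mon d (@irredb F) (fun Q => legendre a Q ^+ pval Q f)).
move=> i /andP[/andP[hi _] _]; rewrite big_seq_cond big1 // => Q /andP[/monP[_ sQ _] _].
by rewrite pval_large // sQ ltnS.
Qed.

(** Only the exponent of Q changes, so the degree of Q and then Q itself are split off from the
    double product. *)
Lemma jacobi_mul_irr (a : {poly F}) Q f : Q \is monic -> irreducible_poly Q -> f != 0 ->
  jacobi a (Q * f) = legendre a Q * jacobi a f.
Proof.
move=> Qm Qi f0; have Q0 := irredp_neq0 Qi.
have sf : (size f <= size (Q * f)%R)%N by rewrite dvdp_leq ?dvdp_mull ?mulf_neq0.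
have sQ : (size Q <= size (Q * f)%R)%N by rewrite dvdp_leq ?dvdp_mulr ?mulf_neq0.
rewrite (jacobi_widen a _ (leqnn _)) ?mulf_neq0 // (jacobi_widen a f0 sf).
pose d0 := (size Q).-1; have sE : size Q = d0.+1 by rewrite prednK // size_poly_gt0.
have Qmon : Q \in mon F d0 by rewrite mem_mon Qm sE eqxx.
have d0r : d0 \in index_iota 1 (size (Q * f)%R).
  by rewrite mem_index_iota; move: Qi.1 sQ; rewrite sE ltnS => -> /= ->.
rewrite (bigD1_seq d0) ?iota_uniq //= [in RHS](bigD1_seq d0) ?iota_uniq //= mulrA.
have other Q' : Q' \is monic -> irredb Q' -> Q' != Q ->
    legendre a Q' ^+ pval Q' (Q * f) = legendre a Q' ^+ pval Q' f.
  by move=> Q'm /irredbP Q'i ne; rewrite (pval_mul_other Qm) // eq_sym.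
congr (_ * _).
  rewrite -[in LHS]big_filter -[in RHS]big_filter.
  have Qin : Q \in [seq Q' <- mon F d0 | irredb Q'] by rewrite mem_filter Qmon andbT; exact/irredbP.
  rewrite (bigD1_seq Q) ?filter_uniq ?mon_uniq //= [in RHS](bigD1_seq Q) ?filter_uniq ?mon_uniq //=.
  rewrite pval_mul_irr // exprS -!mulrA; congr (_ * (_ * _)).
  rewrite big_seq_cond [RHS]big_seq_cond; apply: eq_bigr => Q'.
  by rewrite mem_filter => /andP[/andP[Q'i /monP[Q'm _ _]]]; apply: other.
apply: eq_bigr => d dd; rewrite big_seq_cond [RHS]big_seq_cond.
apply: eq_bigr => Q' /andP[/monP[Q'm s' _] Q'i]; apply: other => //.
by apply: contraNneq dd => e; rewrite /d0 -e s'.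
Qed.

Lemma jacobi_legendre P f : (q %% 4 = 1)%N -> P \is monic -> irreducible_poly P ->
  f \is monic -> jacobi P f = legendre f P.
Proof.
move=> q4 Pm Pi; have oq : odd q by lia.
have [m] := ubnP (size f); elim: m f => // m IH f hm fm.
case: (leqP (size f) 1) => [s1|s1].
  have -> : f = 1 by exact: monic_size_le1.
  have n1 : ~~ (P %| 1).
    by apply: contraL Pi.1 => /(dvdp_leq (oner_neq0 _)); rewrite size_polyC oner_eq0 leqNgt.
  by have := legendre_sqr Pi n1; rewrite expr1n => ->; rewrite /jacobi size_polyC oner_eq0 big_geq.
have [Q [Qm Qi /dvdpP[h fE]]] := irreducible_factor s1.
have hm' : h \is monic by rewrite -(monicMr h Qm) -fE.
rewrite fE mulrC in s1 hm fm *.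
rewrite jacobi_mul_irr ?monic_neq0 // legendreM // IH //; last first.
  rewrite -ltnS (leq_trans _ hm) // ltnS size_monicM ?monic_neq0 //.
  by case: (size Q) Qi.1 => [|[|b]] // _; rewrite !addSn ltnS leq_addl.
congr (_ * _); case: (eqVneq P Q) => [->//|_]; exact: quadratic_reciprocity.
Qed.

End Jacobi.

(** * The functional equation *)

Lemma big_uniq_inj (V : nmodType) (I : eqType) (r : seq I) (f : I -> I) (G : I -> V) :
  uniq r -> {in r &, injective f} -> (forall x, x \in r -> f x \in r) ->
  \sum_(y <- r) G y = \sum_(x <- r) G (f x).
Proof.
move=> ur fi fr; apply: big_uniq_bij => //.
have um : uniq (map f r) by rewrite map_inj_in_uniq.
have sub : {subset map f r <= r} by move=> y /mapP[x xr ->]; apply: fr.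
have [_ e] := uniq_min_size um sub (eq_leq (esym (size_map f r))).
by move=> y; rewrite -e => /mapP[x xr ->]; exists x.
Qed.

Section FunctionalEquation.
Variables (F : finFieldType) (P : {poly F}).
Local Notation q := #|F|.
Hypotheses (oq : odd q) (Pm : P \is monic) (Pi : irreducible_poly P).
Local Notation n := (size P).-1.
Hypothesis on : odd n.
Local Notation chi a := (legendre a P).

Lemma sizeP : size P = n.+1.
Proof. by rewrite prednK // ltnW // Pi.1. Qed.

Lemma small_ndvdp (a : {poly F}) : a != 0 -> (size a <= n)%N -> ~~ (P %| a).
Proof. by move=> a0 sa; apply/negP => /(dvdp_leq a0); rewrite sizeP leqNgt ltnS sa. Qed.

Lemma small_modp (a : {poly F}) : (size a <= n)%N -> a %% P = a.
Proof. by move=> sa; rewrite modp_small // sizeP ltnS. Qed.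

Lemma legendre_modp (a : {poly F}) : chi (a %% P) = chi a.
Proof.
apply: legendre_mod; rewrite -(dvdp_addl _ (dvdp_mull (a %/ P) (dvdpp P))).
by rewrite addrAC [X in X - _]addrC -divp_eq subrr dvdp0.
Qed.

Lemma legendre_mulself (b : {poly F}) : ~~ (P %| b) -> chi b * chi b = 1.
Proof. by move=> nb; rewrite -legendreM // -expr2 legendre_sqr. Qed.

(** For odd n this is the quadratic character of F. *)
Definition eta (c : F) : int := chi c%:P.

Lemma etaM c d : eta (c * d) = eta c * eta d.
Proof. by rewrite /eta polyCM legendreM. Qed.

Lemma eta0 : eta 0 = 0.
Proof. by apply/eqP; rewrite /eta legendre_eq0 // dvdp0. Qed.

Lemma polyC_ndvdp c : c != 0 -> ~~ (P %| c%:P).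
Proof.
move=> c0; apply: small_ndvdp; rewrite ?polyC_eq0 // size_polyC c0.
by have := Pi.1; rewrite sizeP.
Qed.

(** Squaring identifies 1 and -1, so some c is no square in F and c^((q-1)/2) = -1. Euler's exponent
    for P is (q-1)/2 times 1 + q + ... + q^(n-1), a sum of n odd terms, hence odd. *)
Lemma eta_nonresidue : exists c, eta c = -1.
Proof.
have [c nc] : exists c : F, forall d, d ^+ 2 != c.
  case: (pickP (fun c : F => [forall d, d ^+ 2 != c])) => [c /forallP|h]; first by exists c.
  have sur (c : F) : exists d, d ^+ 2 = c.
    have /forallPn[d] := negbT (h c); rewrite negbK => /eqP; by exists d.
  have : codom (fun d : F => d ^+ 2) =i F.
    by move=> c; rewrite [RHS]inE; apply/codomP; have [d <-] := sur c; exists d.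
  move/eq_card/eqP/image_injP => /(_ 1 (-1)) /= /(_ isT isT).
  rewrite sqrrN => /(_ erefl) /eqP; rewrite -subr_eq0 opprK.
  by rewrite -[1 + 1]/(2%:R) (negPf (two_neq0 (idfun : {rmorphism F -> F}) oq)).
have c0 : c != 0 by apply: contraNneq (nc 0) => ->; rewrite expr0n.
exists c; apply: legendre_unique => //.
have c1 : c ^+ q./2 != 1.
  by apply/eqP => /(fin_square oq c0)[d /eqP]; rewrite (negPf (nc d)).
have cm : c ^+ q./2 = -1.
  have : (c ^+ q./2) ^+ 2 == 1.
    apply/eqP/(mulfI c0); rewrite -exprM -exprS muln2 mulr1.
    by rewrite -[RHS]expf_card -[in RHS](odd_double_half q) oq.
  by rewrite sqrf_eq1 (negPf c1) => /eqP.
rewrite half_expn // mulnC exprM -polyC_exp cm polyCN -signr_odd.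
have -> : odd (\sum_(l < n) q ^ l)%N.
  have -> : odd (\sum_(l < n) q ^ l)%N = odd (\sum_(l < n) 1)%N.
    apply: (big_ind2 (fun x y => odd x = odd y)) => // [x1 x2 y1 y2 e1 e2|l _].
      by rewrite !oddD e1 e2.
    by rewrite oddX oq orbT.
  by rewrite sum1_card card_ord on.
by rewrite expr1 rmorphN1 subrr dvdp0.
Qed.

Lemma sum_eta : \sum_c eta c = 0.
Proof.
have [c0 e0] := eta_nonresidue.
have c0n : c0 != 0 by apply: contra_eq_neq e0 => ->; rewrite eta0.
have e : \sum_c eta c = - \sum_c eta c.
  rewrite {1}(reindex_inj (mulfI c0n)) /= -sumrN; apply: eq_bigr => c _.
  by rewrite etaM e0 mulN1r.
by lia.
Qed.

(** The coefficient of 1/T in (a mod P)/P, that is, the residue at infinity up to sign: a linear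
    form on F[T]/P. *)
Definition lam (a : {poly F}) : F := (a %% P)`_n.-1.

(** A Gauss sum with [eta] in place of an additive character; it is an integer. *)
Definition kappa : int := \sum_(a <- pol F n) chi a * eta (lam a).

Lemma kappa_twist (b : {poly F}) : ~~ (P %| b) ->
  \sum_(a <- pol F n) chi a * eta (lam (a * b)) = chi b * kappa.
Proof.
move=> nb; rewrite /kappa [in RHS](@big_uniq_inj _ _ _ (fun a => (a * b) %% P)) ?pol_uniq //.
- rewrite mulr_sumr; apply: eq_bigr => a _ /=.
  by rewrite legendre_modp legendreM // /lam modp_id -[LHS]mul1r
    -(legendre_mulself nb); ring.
- move=> a a'; rewrite !mem_pol => sa sa' /eqP.
  rewrite -subr_eq0 -modpN -modpD -mulNr -mulrDl => /(dvdp_mul_irr Pi).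
  rewrite (negPf nb) orbF => d; apply/eqP; rewrite -subr_eq0; apply: contraTT d => nz.
  apply: small_ndvdp => //.
  by rewrite (leq_trans (size_polyD _ _)) // geq_max size_polyN sa.
- by move=> a _; rewrite mem_pol -ltnS -sizeP ltn_modp irredp_neq0.
Qed.

Lemma lamD a b : lam (a + b) = lam a + lam b.
Proof. by rewrite /lam modpD coefD. Qed.

Lemma n_gt0 : (0 < n)%N.
Proof. by have := Pi.1; rewrite sizeP. Qed.

(* Translating b by t T^i with i = n - size a shifts lam (a * b) by t times the leading
   coefficient of a, so the values of eta cancel. *)
Lemma sum_eta_large j (a : {poly F}) : (size a <= n)%N -> (n - j < size a)%N ->
  \sum_(b <- mon F j) eta (lam (a * b)) = 0.
Proof.
move=> sa la; pose i := (n - size a)%N.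
have ij : (i < j)%N by rewrite /i; lia.
have a0 : a != 0 by rewrite -size_poly_gt0; lia.
have shift t : \sum_(b <- mon F j) eta (lam (a * b))
             = \sum_(b <- mon F j) eta (lam (a * b) + t * lead_coef a).
  rewrite (@big_uniq_inj _ _ _ (fun b => b + t *: 'X^i)) ?mon_uniq //.
  - apply: eq_bigr => b _; rewrite mulrDr lamD; congr (eta (_ + _)).
    rewrite /lam -scalerAr small_modp; last first.
      rewrite (leq_trans (size_scale_leq _ _)) // size_mulXn // /i; lia.
    have iE : (i + size a = n)%N by rewrite subnK.
    have sa0 : (0 < size a)%N by rewrite size_poly_gt0.
    rewrite coefZ coefMXn lead_coefE ifF; last by lia.
    by have -> : (n.-1 - i)%N = (size a).-1 by lia.
  - by move=> b b' _ _ /addIr.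
  - move=> b /monP[bm sb _]; have sX : (size (t *: 'X^i : {poly F}) < size b)%N.
      by rewrite (leq_ltn_trans (size_scale_leq _ _)) // size_polyXn sb.
    by rewrite mem_mon monicE lead_coefDl // (monicP bm) eqxx size_polyDl // sb eqxx.
have : \sum_(t : F) \sum_(b <- mon F j) eta (lam (a * b)) = 0.
  rewrite (eq_bigr _ (fun t _ => shift t)) exchange_big /= big1 // => b _.
  rewrite -[RHS]sum_eta [RHS](reindex_inj (addrI (lam (a * b)))) /=.
  have la0 : lead_coef a != 0 by rewrite lead_coef_eq0.
  by rewrite [RHS](reindex_inj (mulIf la0)).
rewrite big_const iter_addr_0 => /eqP; rewrite mulrn_eq0 => /orP[|/eqP//].
by rewrite eqn0Ngt (ltnW (card_gt1 F)).
Qed.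

(** Here deg (a b) < n, so nothing is reduced modulo P, and b being monic the coefficient of T^(n-1)
    in a b does not depend on b. *)
Lemma sum_eta_small j (a : {poly F}) : (j < n)%N -> (size a <= n - j)%N ->
  \sum_(b <- mon F j) eta (lam (a * b)) = (q ^ j)%:R * eta a`_(n.-1 - j).
Proof.
move=> jn sa; rewrite (eq_big_seq (fun=> eta a`_(n.-1 - j))) => [|b /monP[bm sb b0]].
  by rewrite big_const_seq count_predT size_mon iter_addr_0 mulr_natl.
congr eta; have [->|a0] := eqVneq a 0; first by rewrite mul0r /lam mod0p !coef0.
have sab : size (a * b) = (size a + j)%N by rewrite size_Mmonic // sb addnS.
rewrite /lam small_modp ?sab; last by lia.
have [h|h] := leqP (size a) (n.-1 - j).
  by rewrite !nth_default // sab; lia.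
have sa' : size a = (n - j)%N by lia.
have := lead_coef_Mmonic a bm; rewrite !lead_coefE sab sa'.
have -> : (n - j + j).-1 = n.-1 by lia.
have -> : (n - j).-1 = (n.-1 - j)%N by lia.
by move=> e; exact: e.
Qed.

Definition Acoef j : int := \sum_(f <- mon F j) chi f.

(** Writing a = c f with f monic, the two factors [eta c] cancel, so each of the q - 1 leading
    coefficients c contributes the same sum. *)
Lemma sum_leading m : (m < n)%N ->
  \sum_(a <- pol F m.+1) chi a * eta a`_m = (q.-1)%:R * Acoef m.
Proof.
move=> mn; rewrite (bigID (fun a : {poly F} => a`_m == 0)) /= big1 ?add0r => [|a /eqP->]; last first.
  by rewrite eta0 mulr0.
rewrite -big_filter; pose cs : seq F := [seq c <- enum F | c != 0].
have sz : size cs = q.-1.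
  by rewrite -(cardC1 (0 : F)) cardE /enum_mem size_filter size_filter -enumT; apply: eq_count.
have ucs : uniq cs by apply: filter_uniq; exact: enum_uniq.
have uL : uniq [seq (c, f) | c <- cs, f <- mon F m].
  by apply: allpairs_uniq => //; rewrite ?mon_uniq // => -[] ? ? [].
rewrite (@big_uniq_bij _ (F * {poly F})%type {poly F} [seq (c, f) | c <- cs, f <- mon F m] _ (fun cf => cf.1 *: cf.2)).
- rewrite big_allpairs_dep /= (eq_big_seq (fun=> Acoef m)) => [|c].
    by rewrite big_const_seq count_predT sz iter_addr_0 mulr_natl.
  rewrite mem_filter => /andP[c0 _]; apply: eq_big_seq => f /monP[fm sf _].
  rewrite coefZ; move: fm; rewrite monicE lead_coefE sf /= => /eqP->.
  rewrite mulr1 -mul_polyC legendreM // mulrAC -/(eta c) legendre_mulself ?mul1r //.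
  exact: polyC_ndvdp.
- exact: uL.
- by rewrite filter_uniq ?pol_uniq.
- move=> [c f] [d h] /allpairsP[[? ?] /= [cc /monP[fm _ _] [-> ->]]].
  case/allpairsP => [[? ?] /= [dc /monP[hm _ _] [-> ->]]] e.
  have cd := congr1 (@lead_coef F) e; rewrite !lead_coefZ (monicP fm) (monicP hm) !mulr1 in cd.
  move: e cc; rewrite cd mem_filter => e /andP[d0 _].
  by rewrite (scalerI d0 e).
- move=> _ /allpairsP[[c f] /= [cc /monP[fm sf _] ->]]; move: cc; rewrite mem_filter => /andP[c0 _].
  rewrite mem_filter mem_pol coefZ; move: fm; rewrite monicE lead_coefE sf /= => /eqP->.
  by rewrite mulr1 c0 /= (leq_trans (size_scale_leq _ _)) // sf.
- move=> a; rewrite mem_filter mem_pol => /andP[am sa].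
  have sa' : size a = m.+1.
    apply/eqP; rewrite eqn_leq sa ltnNge; apply: contra am => h.
    by rewrite nth_default.
  exists (a`_m, (a`_m)^-1 *: a); last by rewrite /= scalerA mulfV // scale1r.
  apply/allpairsP; exists (a`_m, (a`_m)^-1 *: a); split=> //=.
    by rewrite mem_filter am mem_enum.
  by rewrite mem_mon monicE lead_coefZ lead_coefE sa' /= mulVf // eqxx size_scale ?invr_eq0 // sa' eqxx.
Qed.

Lemma functional_equation_kappa j : (j < n)%N ->
  kappa * Acoef j = (q ^ j)%:R * ((q.-1)%:R * Acoef (n.-1 - j)).
Proof.
move=> jn; rewrite mulrC /Acoef mulr_suml.
rewrite (eq_big_seq (fun b => \sum_(a <- pol F n) chi a * eta (lam (a * b)))); last first.
  by move=> b /monP[_ sb b0]; rewrite kappa_twist // small_ndvdp // sb.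
rewrite exchange_big /= (eq_bigr (fun a => chi a * \sum_(b <- mon F j) eta (lam (a * b)))); last first.
  by move=> a _; rewrite mulr_sumr.
rewrite (bigID (fun a : {poly F} => size a <= n - j)%N) /= [X in _ + X]big_seq_cond.
rewrite [X in _ + X]big1 ?addr0 => [|a /andP[]]; last first.
  by rewrite mem_pol -ltnNge => sa la; rewrite sum_eta_large // mulr0.
rewrite (eq_bigr (fun a => (q ^ j)%:R * (chi a * eta a`_(n.-1 - j)))) => [|a sa]; last first.
  by rewrite sum_eta_small // mulrCA.
rewrite -mulr_sumr -[\sum_(f <- _) _]/(Acoef _) -sum_leading; last first.
  by apply: leq_ltn_trans (leq_subr _ _) _; rewrite ltn_predL n_gt0.
congr (_ * _); rewrite -big_filter; apply: perm_big; apply: uniq_perm; rewrite ?filter_uniq ?pol_uniq //.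
have e : (n.-1 - j).+1 = (n - j)%N.
  by rewrite -subSn; [rewrite prednK ?n_gt0 | rewrite -ltnS prednK ?n_gt0].
move=> a; rewrite mem_filter !mem_pol e.
by apply/andP/idP => [[]//|sa]; split=> //; apply: leq_trans sa (leq_subr _ _).
Qed.

Lemma Acoef0 : Acoef 0 = 1.
Proof.
have e : perm_eq (mon F 0) [:: 1].
  apply: uniq_perm; rewrite ?mon_uniq // => p; rewrite mem_mon inE.
  apply/andP/eqP => [[pm /eqP sp]|->]; last by rewrite monic1 size_polyC oner_eq0.
  by apply/eqP; rewrite -eqp_monic ?monic1 // -size_poly_eq1 sp.
rewrite /Acoef (perm_big _ e) big_seq1 -(expr1n _ 2) legendre_sqr //.
by rewrite small_ndvdp ?oner_eq0 // size_polyC oner_eq0 n_gt0.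
Qed.

(** The case j = 0 of [functional_equation_kappa] evaluates kappa as (q-1) A_(n-1); the case j = n-1
    then gives the square of A_(n-1), leaving only its sign open. *)
Lemma functional_equation j : (j < n)%N ->
  Acoef n.-1 ^+ 2 = (q ^ n.-1)%:R /\ Acoef n.-1 * Acoef j = (q ^ j)%:R * Acoef (n.-1 - j).
Proof.
move=> jn; have n0 := n_gt0; have q1 : (q.-1)%:R != 0 :> int.
  by rewrite pnatr_eq0 -lt0n -ltnS prednK ?card_gt1 // ltnW // card_gt1.
have kE : kappa = (q.-1)%:R * Acoef n.-1.
  by have := functional_equation_kappa n0; rewrite Acoef0 mulr1 expn0 mul1r subn0.
have main k : (k < n)%N -> Acoef n.-1 * Acoef k = (q ^ k)%:R * Acoef (n.-1 - k).
  move=> kn; apply: (mulfI q1); have := functional_equation_kappa kn.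
  by rewrite kE -mulrA => ->; rewrite mulrCA.
split; last exact: main.
by rewrite expr2 main ?subnn ?Acoef0 ?mulr1 // ltn_predL.
Qed.

End FunctionalEquation.

(** * Counting primes *)

Section PrimeCount.
Variable F : finFieldType.
Local Notation q := #|F|.
Implicit Types P : {poly F}.

Definition primes_of_degree n : seq {poly F} := [seq P <- mon F n | irredb P].

Lemma primes_of_degreeP n P :
  P \in primes_of_degree n -> [/\ P \is monic, irreducible_poly P & size P = n.+1].
Proof. by rewrite mem_filter => /andP[/irredbP Pi /monP[Pm sP _]]. Qed.

Lemma primes_of_degree_uniq n : uniq (primes_of_degree n).
Proof. by rewrite filter_uniq // mon_uniq. Qed.

Lemma prod_irr_dvdp (s : seq {poly F}) (G : {poly F}) :
  uniq s -> (forall P, P \in s -> [/\ P \is monic, irreducible_poly P & P %| G]) ->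
  \prod_(P <- s) P %| G.
Proof.
elim: s => [|P s IH] /=; first by rewrite big_nil dvd1p.
move=> /andP[nin us] h; rewrite big_cons.
have [Pm Pi Pd] := h P (mem_head _ _).
rewrite Gauss_dvdp ?Pd ?IH // => [P' P's|]; first by apply: h; rewrite inE P's orbT.
rewrite big_seq; apply: (big_ind (coprimep P)) => [|a b ca cb|P' P's].
- exact: coprimep1.
- by rewrite coprimepMr ca.
have [P'm P'i _] : [/\ P' \is monic, irreducible_poly P' & P' %| G] by apply: h; rewrite inE P's orbT.
by apply: monic_irr_coprime => //; apply: contraNneq nin => ->.
Qed.

Lemma size_prod_primes (s : seq {poly F}) n : {subset s <= primes_of_degree n} ->
  size (\prod_(P <- s) P) = (size s * n).+1.
Proof.
elim: s => [|P s IH] h; first by rewrite big_nil size_polyC oner_eq0.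
have [Pm Pi sP] := primes_of_degreeP (h P (mem_head _ _)).
have hs : {subset s <= primes_of_degree n} by move=> Q Qs; apply: h; rewrite inE Qs orbT.
have m : \prod_(P <- s) P \is monic.
  by rewrite big_seq; apply: monic_prod => Q /hs/primes_of_degreeP[].
by rewrite big_cons size_Mmonic ?monic_neq0 // IH //= sP mulSn addSn addnS.
Qed.

Lemma count_primes_dvdp (s : seq {poly F}) n (G : {poly F}) :
  G != 0 -> uniq s -> (forall P, P \in s -> P \in primes_of_degree n /\ P %| G) ->
  (size s * n < size G)%N.
Proof.
move=> G0 us h; rewrite -(@size_prod_primes s n) => [|P /h[]//].
apply: dvdp_leq => //; apply: prod_irr_dvdp => // P /h[/primes_of_degreeP[Pm Pi _] Pd] //.
Qed.

Lemma irr_dvdp_XqX n P : P \is monic -> irreducible_poly P -> size P = n.+1 ->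
  P %| 'X^(q ^ n) - 'X.
Proof.
move=> Pm Pi sP; have [K [pi [pi0 cK _]]] := residue_field Pm Pi.
by rewrite -pi0 rmorphB rmorphXn /= -[n]/(n.+1.-1) -sP -cK expf_card subrr.
Qed.

Lemma prime_count_upper n : (0 < n)%N -> (size (primes_of_degree n) * n <= q ^ n)%N.
Proof.
move=> n0; rewrite -ltnS -(@size_XqX F F) //; apply: count_primes_dvdp.
- by rewrite -size_poly_eq0 size_XqX.
- exact: primes_of_degree_uniq.
- by move=> P Pin; split=> //; have [Pm Pi sP] := primes_of_degreeP Pin; apply: irr_dvdp_XqX.
Qed.

Lemma separable_dvdp (f D : {poly F}) : f \is monic -> separable_poly f ->
  (forall P, P \is monic -> irreducible_poly P -> P %| f -> P %| D) -> f %| D.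
Proof.
have [m] := ubnP (size f); elim: m f => // m IH f hm fm fs h.
case: (leqP (size f) 1) => [s1|s1].
  have -> : f = 1 by exact: monic_size_le1.
  exact: dvd1p.
have [P [Pm Pi /dvdpP[k fE]]] := irreducible_factor s1.
have km : k \is monic by rewrite -(monicMr k Pm) -fE.
move: fs; rewrite fE separable_mul => /and3P[ks _ cop].
rewrite Gauss_dvdp // (h P) ?fE ?dvdp_mull // andbT; apply: IH => // [|Q Qm Qi Qd].
  rewrite -ltnS (leq_trans _ hm) // ltnS fE size_Mmonic ?monic_neq0 //.
  by case: (size P) Pi.1 => [|[|b]] // _; rewrite !addnS ltnS leq_addr.
by apply: h => //; rewrite fE dvdp_mulr.
Qed.

Lemma XqX_separable n : (0 < n)%N -> separable_poly ('X^(q ^ n) - 'X : {poly F}).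
Proof.
move=> n0; rewrite separable_poly.unlock derivB derivXn derivX.
have -> : 'X^((q ^ n).-1) *+ (q ^ n) = 0 :> {poly F}.
  have [p [e [pr chp e0 qE]]] := card_prime_power F.
  have chX : p \in [pchar {poly F}] by exact: (rmorph_pchar (polyC : {rmorphism F -> {poly F}}) chp).
  rewrite -mulr_natl -(prednK n0) expnS qE -(prednK e0) expnS -mulnA natrM.
  by rewrite (pcharf0 chX) !mul0r.
by apply/Bezout_coprimepP; exists (0, -1); rewrite /= sub0r mul0r add0r mulrNN mulr1 eqpxx.
Qed.

(** The class x of T modulo P is fixed by the powers q^d and q^n, hence by q^(n-d) when d < n. As
    its Frobenius orbit has length d, d <= n - d. This is weaker than d | n but suffices. *)
Lemma prime_degree_le n d P : (0 < n)%N -> P \is monic -> irreducible_poly P -> size P = d.+1 ->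
  P %| 'X^(q ^ n) - 'X -> d = n \/ (d <= n./2)%N.
Proof.
move=> n0 Pm Pi sP; have [K [pi [pi0 cK pis]]] := residue_field Pm Pi.
pose i : {rmorphism F -> K} := pi \o polyC; pose x := pi 'X.
rewrite -pi0 rmorphB rmorphXn /= subr_eq0 -/x => /eqP xn.
have rx : root (map_poly i P) x.
  by rewrite rootE (horner_residue pi P : (map_poly i P).[x] = _) pi0.
have orb k : (0 < k)%N -> x ^+ (q ^ k) = x -> (d <= k)%N.
  by move=> k0 e; have := frobenius_orbit Pm Pi rx k0 e; rewrite sP.
have dn := orb n n0 xn.
have xd : x ^+ (q ^ d) = x by rewrite -[RHS]expf_card cK sP.
case: (ltngtP d n) dn => // [dn _|->]; last by left.
right; have h : (d <= n - d)%N; last by lia.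
apply: orb; first by rewrite subn_gt0.
by rewrite -{1}xd -exprM -expnD subnKC // ltnW.
Qed.

Lemma monic_prod_primes n : \prod_(P <- primes_of_degree n) P \is monic.
Proof. by rewrite big_seq; apply: monic_prod => Q /primes_of_degreeP[]. Qed.

Lemma size_prod_primes_le g :
  (size (\prod_(1 <= d < g.+1) \prod_(P <- primes_of_degree d) P)%R <= q ^ g.+1)%N.
Proof.
elim: g => [|g IH]; first by rewrite big_nil size_polyC oner_eq0 expn1 ltnW // card_gt1.
rewrite big_nat_recr //= size_Mmonic ?monic_prod_primes //; last first.
  by rewrite monic_neq0 //; apply: monic_prod => d _; apply: monic_prod_primes.
rewrite (@size_prod_primes _ g.+1 (fun _ => id)) addnS /=.
apply: leq_trans (leq_add IH (prime_count_upper (ltn0Sn g))) _.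
by rewrite addnn -mul2n [(q ^ g.+2)%N]expnS leq_mul2r card_gt1 orbT.
Qed.

(** T^(q^n) - T is separable, so it divides the product of its prime factors. Those of degree other
    than n have degree at most g, and all primes of such degrees have a product of degree below
    q^(g+1). *)
Lemma prime_count_lower g :
  (q ^ (2 * g + 1) <= size (primes_of_degree (2 * g + 1)) * (2 * g + 1) + q ^ g.+1)%N.
Proof.
set n := (2 * g + 1)%N; have n0 : (0 < n)%N by rewrite /n addn1.
pose D := \prod_(1 <= d < g.+1) \prod_(P <- primes_of_degree d) P.
pose E := \prod_(P <- primes_of_degree n) P.
have Dmon : D \is monic by apply: monic_prod => d _; apply: monic_prod_primes.
have dv : 'X^(q ^ n) - 'X %| D * E.
  apply: separable_dvdp; last 1 first.
  - move=> P Pm Pi Pd; pose d := (size P).-1.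
    have sP : size P = d.+1 by rewrite prednK // ltnW // Pi.1.
    have Pin : P \in primes_of_degree d.
      by rewrite mem_filter mem_mon Pm sP eqxx !andbT; apply/irredbP.
    have dd : P %| \prod_(Q <- primes_of_degree d) Q by rewrite (big_rem P) //= dvdp_mulr.
    have [dn|dn] := prime_degree_le n0 Pm Pi sP Pd.
      by rewrite dvdp_mull // /E -dn.
    rewrite dvdp_mulr // /D (bigD1_seq d) ?iota_uniq ?dvdp_mulr //= mem_index_iota.
    by have := Pi.1; rewrite sP ltnS => -> /=; move: dn; rewrite /n; lia.
  - by rewrite monicE lead_coefDl ?lead_coefXn // size_polyN size_polyX size_polyXn ltnS
     (leq_trans (card_gt1 F)) // -{1}(expn1 q) leq_exp2l ?card_gt1.
  - exact: XqX_separable.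
have Em : E \is monic by exact: monic_prod_primes.
have := dvdp_leq _ dv; rewrite size_XqX // size_Mmonic ?monic_neq0 ?monicMr // => /(_ isT).
have := size_prod_primes_le g; rewrite -/D /E (@size_prod_primes _ n (fun _ => id)) addnS /= => h1 h2.
by apply: leq_trans (ltnW h2) _; rewrite addnC leq_add2l.
Qed.

End PrimeCount.

(** * Stepanov's method *)

Lemma uphalf_odd k : odd k -> (uphalf k * 2 = k.+1)%N.
Proof. by move=> ok; rewrite uphalf_half ok; have := odd_double_half k; rewrite ok; lia. Qed.

Section Stepanov.
Variable F : finFieldType.
Local Notation q := #|F|.
Implicit Types a d f P : {poly F}.

Lemma poly_frobenius k a : a ^+ (q ^ k) = a \Po 'X^(q ^ k).
Proof.
rewrite comp_polyE -{1}[a]coefK poly_def (frobenius_sum polyC).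
by apply: eq_bigr => j _; rewrite exprZn expf_cardX exprAC.
Qed.

Lemma dvdp_small_eq0 r a : (size a <= r)%N -> 'X^r %| a -> a = 0.
Proof.
move=> sa d; apply/eqP; apply: contraTT d => a0; apply/negP => /(dvdp_leq a0).
by rewrite size_polyXn ltnNge sa.
Qed.

Lemma Xdvdp a : ('X %| a) = (a.[0] == 0).
Proof. by rewrite -['X]subr0 -polyC0 dvdp_XsubCl rootE. Qed.

(** The quotient b = a/d satisfies b^2 = c f, and leading coefficients show that c is itself a
    square. *)
Lemma square_quotient f a d (c : F) : f \is monic -> d != 0 -> a ^+ 2 = c *: (f * d ^+ 2) ->
  c != 0 -> exists e, f = e ^+ 2.
Proof.
move=> fm d0 e c0; have /dvdpP[b aE] : d %| a.
  by rewrite -(dvdp_pexp2r _ _ (ltn0Sn 1)) e dvdpZr // dvdp_mull.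
have be : b ^+ 2 = c *: f.
  by apply: (mulIf (expf_neq0 2 d0)); rewrite -exprMn -aE e scalerAl.
have lb : lead_coef b ^+ 2 = c.
  by rewrite expr2 -lead_coefM -expr2 be lead_coefZ (monicP fm) mulr1.
exists ((lead_coef b)^-1 *: b); rewrite exprZn be scalerA exprVn lb mulVf ?scale1r //.
Qed.

(* If f(0) <> 0 then f^r = f(0) mod X^r, so that multiplying by the conjugate turns
   the congruence into the equation a^2 = f(0) f d^2. *)
Lemma local_independence k m la ld f a d (r := (q ^ k)%N) (h := (uphalf r)%N) :
  odd q -> f \is monic -> (forall e, f <> e ^+ 2) -> ~~ ('X ^+ 2 %| f) ->
  size f = m.+1 -> (size a <= la)%N -> (size d <= ld)%N ->
  (2 * la <= r.+1)%N -> (m + 2 * ld <= r.+1)%N -> (ld + h <= r)%N ->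
  'X^r %| a + f ^+ h * d -> a = 0 /\ d = 0.
Proof.
move=> oq fm fns x2 sf sa sd la_r ld_r ldh dv.
have or : odd r by rewrite oddX oq orbT.
have h2 : (h * 2 = r.+1)%N := uphalf_odd or.
have f0 := monic_neq0 fm.
have dv2 : 'X^r %| a ^+ 2 - f ^+ r * (f * d ^+ 2).
  have -> : a ^+ 2 - f ^+ r * (f * d ^+ 2) = (a + f ^+ h * d) * (a - f ^+ h * d).
    by rewrite [RHS]mulrC -subr_sqr exprMn -exprM h2 [f ^+ _.+1]exprSr mulrA.
  exact: dvdp_mulr.
have sa2 : (size (a ^+ 2)%R <= r)%N.
  by rewrite expr2; apply: leq_trans (size_polyMleq _ _) _; lia.
have sfd : (size (f * d ^+ 2)%R <= r)%N.
  have [->|d0] := eqVneq d 0; first by rewrite expr0n mulr0 size_poly0.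
  have : (0 < size d)%N by rewrite size_poly_gt0.
  rewrite expr2 !size_mul ?mulf_neq0 // sf; move: (size d) sd => s; lia.
(* If X divides f, then X^r divides f^r and so a^2, which is too short not to vanish. As X divides f
   only once, cancelling X^h leaves X^(r-h) dividing d. *)
have [fz|fz] := eqVneq f.[0] 0.
  have /dvdpP[f1 fE] : 'X %| f by rewrite Xdvdp fz.
  have a0 : a = 0.
    have : 'X^r %| a ^+ 2.
      by rewrite -(dvdp_subl _ (_ : 'X^r %| f ^+ r * (f * d ^+ 2))) // dvdp_mulr // dvdp_exp2r // fE dvdp_mull.
    by move/(dvdp_small_eq0 sa2)/eqP; rewrite expf_eq0 /= => /eqP.
  split=> //; apply: (@dvdp_small_eq0 (r - h)%N); first by lia.
  have hr : (h <= r)%N by lia.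
  move: dv; rewrite a0 add0r fE exprMn -{1}(subnK hr) exprD mulrAC dvdp_mul2r ?expf_neq0 ?polyX_eq0 //.
  rewrite Gauss_dvdpr // coprimep_expl // coprimep_expr //.
  rewrite coprimep_sym -['X]subr0 -polyC0 coprimep_XsubC rootE -Xdvdp.
  by apply: contra x2 => /dvdpP[f2 f2E]; rewrite fE f2E -mulrA -expr2 dvdp_mull.
have dvc : 'X^r %| f ^+ r - f.[0]%:P.
  have -> : f ^+ r - f.[0]%:P = (f - f.[0]%:P) ^+ r.
    by rewrite (frobeniusB polyC) -polyC_exp expf_cardX.
  by rewrite dvdp_exp2r // Xdvdp !hornerE subrr.
have e : a ^+ 2 = f.[0] *: (f * d ^+ 2).
  apply/eqP; rewrite -subr_eq0; apply/eqP; apply: (@dvdp_small_eq0 r).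
    rewrite (leq_trans (size_polyD _ _)) // geq_max sa2 size_polyN.
    exact: leq_trans (size_scale_leq _ _) sfd.
  have -> : a ^+ 2 - f.[0] *: (f * d ^+ 2) =
     (a ^+ 2 - f ^+ r * (f * d ^+ 2)) + (f ^+ r - f.[0]%:P) * (f * d ^+ 2).
    by rewrite mulrBl mul_polyC addrA subrK.
  by rewrite dvdp_add // dvdp_mulr.
have [dz|d0] := eqVneq d 0; last first.
  by have [b /fns] := square_quotient fm d0 e fz.
split=> //; move/eqP: e; rewrite dz expr0n mulr0 scaler0 expf_eq0 /=; by move/eqP.
Qed.

Lemma size_mul_le a d s t :
  (size a <= s.+1)%N -> (size d <= t.+1)%N -> (size (a * d)%R <= (s + t).+1)%N.
Proof.
move=> sa sd; apply: leq_trans (size_polyMleq _ _) _.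
by move: (size a) (size d) sa sd => x y; lia.
Qed.

Lemma size_add_le a d s : (size a <= s)%N -> (size d <= s)%N -> (size (a + d)%R <= s)%N.
Proof. by move=> sa sd; rewrite (leq_trans (size_polyD _ _)) // geq_max sa. Qed.

Lemma size_exp_le a s k : (size a <= s.+1)%N -> (size (a ^+ k)%R <= (s * k).+1)%N.
Proof.
move=> sa; elim: k => [|k IH]; first by rewrite size_polyC oner_eq0 muln0.
by rewrite exprS mulnS size_mul_le.
Qed.

Lemma size_comp_Xn_le a s k : (size a <= s.+1)%N -> (size (a \Po 'X^k) <= (s * k).+1)%N.
Proof.
move=> sa; apply: leq_trans (size_comp_poly_leq _ _) _.
by rewrite size_polyXn ltnS leq_mul //; move: (size a) sa => x; lia.
Qed.

Lemma size_sum_le (I : Type) (s : seq I) (G : I -> {poly F}) N :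
  (forall i, (size (G i) <= N)%N) -> (size (\sum_(i <- s) G i)%R <= N)%N.
Proof.
move=> h; elim: s => [|i s IH]; first by rewrite big_nil size_poly0.
by rewrite big_cons size_add_le.
Qed.

Lemma size_intmul_le (z : int) a : (size (z%:~R * a)%R <= size a)%N.
Proof. by rewrite mulrzl -scaler_int size_scale_leq. Qed.

Variables (g m : nat) (f : {poly F}) (eps : int).
Local Notation R := (q ^ g)%N.
Local Notation r := (q ^ g.+1)%N.
Local Notation n := (2 * g + 1)%N.
Local Notation rho := (q ^ g)./2.
Local Notation J := (rho + m + 1)%N.
Hypotheses (oq : odd q) (fm : f \is monic) (fns : forall e, f <> e ^+ 2)
  (fX : ~~ ('X ^+ 2 %| f)) (sf : size f = m.+1) (m_gt0 : (0 < m)%N) (mg : (m <= 2 * g)%N).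

Lemma R_odd : R = (2 * rho + 1)%N.
Proof. have := odd_double_half R; rewrite oddX oq orbT; lia. Qed.

Hypothesis q5 : (5 <= q)%N.

(** For a_j, [local_independence] asks for 2 (rho + 1 + m) <= r + 1, that is R + 2m <= r, with m up
    to 2g. *)
Lemma r_large : (R + 4 * g <= r)%N.
Proof.
have gR : (g < R)%N by rewrite ltn_expl // card_gt1.
have : (5 * R <= r)%N by rewrite expnS leq_mul2r q5 orbT.
by lia.
Qed.

(** The a_j have m coefficients more than the d_j: J (2 rho + 2 + m) free coefficients face a target
    of size J (2 rho + 2), a surplus of J m > 0. *)
Local Notation T := {ffun 'I_J -> {poly_(rho + 1 + m) F} * {poly_(rho + 1) F}}.

(* (Sum_j (a_j + f^((r+1)/2) d_j) X^(j r))^R, with a_j, d_j the two components of v j,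
   simplified by X^(q^n) = X and f^((q^n-1)/2) = eps. *)
Definition reduced_form (v : T) : {poly F} :=
  \sum_(j < J) ((v j).1 \Po 'X^R + eps%:~R * f ^+ rho.+1 * ((v j).2 \Po 'X^R)) * 'X^j.

Lemma size_reduced_form v : (size (reduced_form v) <= (2 * rho + 2) * (rho + m + 1))%N.
Proof.
apply: size_sum_le => j; have jJ := ltn_ord j.
have s1 : (size (v j).1 <= (rho + m).+1)%N by rewrite -addSn -[rho.+1]addn1 size_npoly.
have s2 : (size (v j).2 <= rho.+1)%N by rewrite -[rho.+1]addn1 size_npoly.
have h1 : (size ((v j).1 \Po 'X^R) <= ((rho + m) * R).+1)%N.
  exact: size_comp_Xn_le.
have h2 : (size (eps%:~R * f ^+ rho.+1 * ((v j).2 \Po 'X^R))%R <= ((rho + m) * R).+1)%N.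
  rewrite -mulrA; apply: leq_trans (size_intmul_le _ _) _.
  apply: leq_trans (size_mul_le (size_exp_le rho.+1 (eq_leq sf)) (size_comp_Xn_le R s2)) _.
  rewrite ltnS; move: R_odd; move: (_./2)%N => p; move: (q ^ g)%N => t ->; nia.
apply: leq_trans (size_mul_le (size_add_le h1 h2) (eq_leq (size_polyXn _ j))) _.
move: jJ R_odd; move: (nat_of_ord j) => i; move: (_./2)%N => p; move: (q ^ g)%N => t ij ->; nia.
Qed.

(* There are more families v than polynomials of the size allowed by size_reduced_form. *)
Lemma reduced_form_kernel : exists v w : T, v != w /\ reduced_form v = reduced_form w.
Proof.
pose D := ((2 * rho + 2) * (rho + m + 1))%N.
pose Phi (v : T) : {poly_D F} := npolyp D (reduced_form v).
case: (boolP (injectiveb Phi)) => [/injectiveP/leq_card|/injectivePn[v [w vw e]]].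
  rewrite card_ffun card_prod !card_npoly card_ord -expnD -expnM leq_exp2l ?card_gt1 //.
  by rewrite /D; nia.
exists v, w; split=> //.
by move/(congr1 val): e; rewrite /= !npolypK ?size_reduced_form.
Qed.

Definition auxiliary (a d : 'I_J -> {poly F}) : {poly F} :=
  \sum_(j < J) (a j + f ^+ (uphalf r) * d j) * 'X^(j * r).

(** Thus the R-th power of f^((r+1)/2) is f^((q^n-1)/2) f^(rho+1), whose first factor is eps modulo
    P. *)
Lemma half_rR : (uphalf r * R = (q ^ n)./2 + rho.+1)%N.
Proof.
have e : (q ^ n = r * R)%N by rewrite -expnD; congr (_ ^ _)%N; lia.
have or : odd r by rewrite oddX oq orbT.
have h2 := uphalf_odd or.
have h3 : ((q ^ n)./2 * 2 + 1 = r * R)%N.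
  by have := odd_double_half (q ^ n); rewrite oddX oq orbT -e; lia.
by have := R_odd; nia.
Qed.

(** A field has no nilpotents, so it suffices that the R-th power vanishes modulo P. There Frobenius
    turns a_j into a_j(X^R) and X^(j r) into X^(j q^n), which is X^j modulo P. *)
Lemma auxiliary_root (a d : 'I_J -> {poly F}) P :
  \sum_(j < J) (a j \Po 'X^R + eps%:~R * f ^+ rho.+1 * (d j \Po 'X^R)) * 'X^j = 0 ->
  P \is monic -> irreducible_poly P -> size P = n.+1 -> legendre f P = eps ->
  P %| auxiliary a d.
Proof.
move=> e0 Pm Pi sP le; have := legendre_euler f oq Pm Pi; rewrite le sP /=.
have [K [pi [pi0 cK _]]] := residue_field Pm Pi.
rewrite -!pi0 rmorphB rmorphXn /= rmorph_int subr_eq0 => /eqP fe.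
have half_x : pi 'X ^+ (q ^ n) = pi 'X by rewrite -[RHS]expf_card cK sP.
have rR : (q ^ n = r * R)%N by rewrite -expnD; congr (_ ^ _)%N; lia.
suff : pi (auxiliary a d) ^+ R == 0 by rewrite expf_eq0 => /andP[].
rewrite -rmorphXn -(rmorph0 pi) -e0 (frobenius_sum polyC) !rmorph_sum; apply/eqP.
apply: eq_bigr => j _.
have -> : ((a j + f ^+ uphalf r * d j) * 'X^(j * r)) ^+ R =
    (a j \Po 'X^R + f ^+ ((q ^ n)./2 + rho.+1) * (d j \Po 'X^R)) * 'X^(j * q ^ n).
  rewrite exprMn (frobeniusD polyC) exprMn -(poly_frobenius g (a j)) -(poly_frobenius g (d j)).
  by rewrite -!exprM -half_rR rR -mulnA.
rewrite exprD [(j * _)%N]mulnC [X in _ * X]exprM; move: (a j \Po 'X^R) (d j \Po 'X^R) => a' d'.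
rewrite !(rmorphM, rmorphD) rmorph_int /= !rmorphXn /=. by rewrite fe half_x.
Qed.

(** The blocks overlap, since f^((r+1)/2) may be long, but their lowest terms do not: once the
    blocks before j vanish, the later ones are multiples of X^((j+1) r), so X^r divides a_j +
    f^((r+1)/2) d_j. *)
Lemma auxiliary_eq0 (a d : 'I_J -> {poly F}) :
  (forall j, size (a j) <= rho + 1 + m)%N -> (forall j, size (d j) <= rho + 1)%N ->
  auxiliary a d = 0 -> forall j, a j = 0 /\ d j = 0.
Proof.
move=> sa sd e0 j; have [k] := ubnP (val j); elim: k j => // k IH j hj.
have lrg := r_large; have ro := R_odd; have or : odd r by rewrite oddX oq orbT.
have h2 := uphalf_odd or.
apply: (@local_independence g.+1 _ _ _ _ _ _ oq fm fns fX sf (sa j) (sd j)); try lia.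
have X0 : 'X^(j * r) != 0 :> {poly F} by rewrite expf_neq0 ?polyX_eq0.
rewrite -(dvdp_mul2r _ _ X0) -exprD -mulSn.
move: e0; rewrite /auxiliary (bigD1 j) //= => /eqP; rewrite addr_eq0 => /eqP ->.
rewrite dvdpNr; apply: (big_ind (fun b : {poly F} => 'X^(j.+1 * r) %| b)) => [|x y|i ij].
- exact: dvdp0.
- exact: dvdp_add.
case: (ltngtP i j) ij => [lij _|lij _|/val_inj->]; last by rewrite eqxx.
  by have [-> ->] := IH i (leq_trans lij hj); rewrite mulr0 addr0 mul0r dvdp0.
by rewrite dvdp_mull // dvdp_exp2l // leq_mul2r lij orbT.
Qed.

(** Two distinct families with the same reduced form differ, by linearity, by a family with zero
    reduced form and non-zero auxiliary polynomial. *)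
Lemma stepanov :
  (2 * (size [seq P <- primes_of_degree F n | legendre f P == eps] * n) <= q ^ n + 4 * m * r)%N.
Proof.
have [v [w [vw vwE]]] := reduced_form_kernel.
pose a j : {poly F} := val (v j).1 - val (w j).1; pose d j : {poly F} := val (v j).2 - val (w j).2.
have sa j : (size (a j) <= rho + 1 + m)%N by rewrite size_add_le ?size_polyN ?size_npoly.
have sd j : (size (d j) <= rho + 1)%N by rewrite size_add_le ?size_polyN ?size_npoly.
have aux0 : auxiliary a d != 0.
  apply: contra_neq vw => /(auxiliary_eq0 sa sd) e; apply/ffunP => j.
  have [/subr0_eq e1 /subr0_eq e2] := e j.
  by case: (v j) (w j) e1 e2 => [? ?] [? ?] /= /val_inj-> /val_inj->.
have red0 : \sum_(j < J) (a j \Po 'X^R + eps%:~R * f ^+ rho.+1 * (d j \Po 'X^R)) * 'X^j = 0.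
  transitivity (reduced_form v - reduced_form w); last by rewrite vwE subrr.
  rewrite /reduced_form -sumrB; apply: eq_bigr => j _.
  by rewrite !comp_polyB !mulrBr -mulrBl opprD addrACA.
have szs : (size [seq P <- primes_of_degree F n | legendre f P == eps] * n < size (auxiliary a d))%N.
  apply: count_primes_dvdp => //; first by rewrite filter_uniq // primes_of_degree_uniq.
  move=> P; rewrite mem_filter => /andP[/eqP le Pin]; split=> //.
  by have [Pm Pi sP] := primes_of_degreeP Pin; exact: (auxiliary_root red0 Pm Pi sP le).
have sz : (size (auxiliary a d) <= (m * uphalf r + rho + m + (rho + m) * r).+1)%N.
  apply: size_sum_le => j; apply: size_mul_le; last first.
    by rewrite size_polyXn ltnS leq_mul //; have := ltn_ord j; lia.
  apply: size_add_le; first by apply: leq_trans (sa j) _; rewrite addnAC addn1 ltnS -addnA leq_addl.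
  have sd' : (size (d j) <= rho.+1)%N by rewrite -addn1.
  apply: leq_trans (size_mul_le (size_exp_le (uphalf r) (eq_leq sf)) sd') _; rewrite ltnS leq_addr //.
have or : odd r by rewrite oddX oq orbT.
have h2 := uphalf_odd or.
have e : (q ^ n = r * R)%N by rewrite -expnD; congr (_ ^ _)%N; lia.
have lrg := r_large; have ro := R_odd.
have hN : (size [seq P <- primes_of_degree F n | legendre f P == eps] * n <=
    m * uphalf r + rho + m + (rho + m) * r)%N by rewrite -ltnS (leq_trans szs sz).
(* Twice the degree contains m r from f^((r+1)/2) and 2 m r from the m extra blocks; a fourth m r
   absorbs 3 m. *)
have mr : (3 * m <= m * r)%N by rewrite mulnC leq_mul2l; apply/orP; right; lia.
have e1 : (2 * (m * uphalf r) = m * r + m)%N by rewrite mulnCA mulnC [(2 * _)%N]mulnC h2 mulSn addnC mulnC.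
have e2 : (2 * ((rho + m) * r) + r = r * R + 2 * (m * r))%N.
  move: ro; move: (q ^ g.+1)%N => y; move: (_./2)%N => p; move: (q ^ g)%N => t ->; nia.
by rewrite e -mulnA; lia.
Qed.

End Stepanov.

(** * Character sums over primes *)

Lemma uniq_flatten_map (I T : eqType) (s : seq I) (G : I -> seq T) :
  uniq s -> (forall i, uniq (G i)) ->
  (forall i j x, x \in G i -> x \in G j -> i = j) -> uniq (flatten (map G s)).
Proof.
move=> us ug dis; elim: s us => //= i s IH /andP[nis us].
rewrite cat_uniq ug IH // andbT /=; apply/hasPn => x /flatten_mapP[j js xj].
by apply: contra nis => xi; rewrite (dis i j x).
Qed.

Section CharacterSum.
Variable F : finFieldType.
Local Notation q := #|F|.
Hypotheses (oq : odd q) (q5 : (5 <= q)%N).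

Lemma sum_legendre_count (s : seq {poly F}) f :
  \sum_(P <- s) legendre f P =
  (count (fun P => legendre f P == 1) s)%:R - (count (fun P => legendre f P == -1) s)%:R.
Proof.
elim: s => [|P s IH]; first by rewrite big_nil.
by rewrite big_cons IH /= !natrD; case/or3P: (legendre_val f P) => /eqP-> /=; ring.
Qed.

Lemma count_legendre (s : seq {poly F}) f : (forall P, P \in s -> ~~ (P %| f)) ->
  (count (fun P => legendre f P == 1) s + count (fun P => legendre f P == -1)%R s)%N = size s.
Proof.
elim: s => // P s IH h /=; have nP := h P (mem_head _ _).
rewrite -IH => [|Q Qs]; last by apply: h; rewrite inE Qs orbT.
by have := legendre_val f P; rewrite legendre_eq0 (negPf nP) /= => /orP[]/eqP->; rewrite /=; lia.
Qed.

(** No P of this degree divides f, so the counts for 1 and -1 add up to all primes, and the upper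
    bound for one is a lower bound for the other. *)
Lemma char_sum_bound_sqfreeX g f : f \is monic -> (forall e, f <> e ^+ 2) ->
  ~~ ('X ^+ 2 %| f) -> (size f <= 2 * g + 1)%N ->
  `|\sum_(P <- primes_of_degree F (2 * g + 1)) legendre f P| <= (5 * q ^ g.+1)%:R.
Proof.
move=> fm fns fX sf; set n := (2 * g + 1)%N; set s := primes_of_degree F n.
have s1 : (1 < size f)%N.
  rewrite ltnNge; apply/negP => h; apply: (fns 1); rewrite expr1n.
  exact: monic_size_le1.
pose m := (size f).-1; have sfm : size f = m.+1 by rewrite prednK // ltnW.
have m0 : (0 < m)%N by move: s1; rewrite sfm.
have mg : (m <= 2 * g)%N by move: sf; rewrite sfm addn1.
have st e : (2 * (count (fun P => legendre f P == e) s * n) <= q ^ n + 4 * m * q ^ g.+1)%N.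
  by rewrite -size_filter; apply: stepanov.
have ndv P : P \in s -> ~~ (P %| f).
  move=> /primes_of_degreeP[Pm Pi sP]; apply/negP => /(dvdp_leq (monic_neq0 fm)).
  by rewrite sP leqNgt ltnS sf.
have := count_legendre ndv; have := prime_count_lower F g; rewrite -/n -/s.
have := st 1; have := st (-1); rewrite sum_legendre_count.
move: (count _ s) (count _ s) (size s) => a b c.
have r0 : (0 < q ^ g.+1)%N by rewrite expn_gt0; lia.
have nm : (m * q ^ g.+1 <= n * q ^ g.+1)%N by rewrite leq_mul2r; apply/orP; right; lia.
have n0 : (0 < n)%N by rewrite /n addn1.
have rn : (q ^ g.+1 <= n * q ^ g.+1)%N by rewrite leq_pmull.
move: nm rn; rewrite -!mulnA; move: (q ^ g.+1)%N (q ^ n)%N => r Q nm rn hb ha hc abc.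
(* The gap y - x = 2 y - c, times n, is at most 4 m r + r <= 5 n r: the 4 is that of [stepanov], the
   1 is the error in counting primes. *)
have key x y : (x + y = c)%N -> (2 * (y * n) <= Q + 4 * (m * r))%N -> (y <= x + 5 * r)%N.
  move=> xyc hy; rewrite -(leq_pmul2r n0).
  have e : (c * n = x * n + y * n)%N by rewrite -xyc mulnDl.
  by rewrite mulnDl -mulnA [(r * n)%N]mulnC; move: e hc; lia.
have h1 := key a b abc hb.
have h2 := key b a _ ha; rewrite addnC in h2; have {}h2 := h2 abc.
rewrite ler_norml lerBlDr lerBrDr; lia.
Qed.

(** Factors X^2 are dropped until the previous bound applies. Their symbol is 1, as g > 0 makes deg
    P > 1 and so keeps P from dividing X. *)
Lemma char_sum_bound g f : (0 < g)%N -> f \is monic -> (forall e, f <> e ^+ 2) ->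
  (size f <= 2 * g + 1)%N ->
  `|\sum_(P <- primes_of_degree F (2 * g + 1)) legendre f P| <= (5 * q ^ g.+1)%:R.
Proof.
move=> g0; have [k] := ubnP (size f); elim: k f => // k IH f hk fm fns sf.
case: (boolP ('X ^+ 2 %| f)) => [/dvdpP[h fE]|fX]; last exact: char_sum_bound_sqfreeX.
have hm : h \is monic by rewrite -(monicMr h (monicXn F 2)) -fE.
have sh : size f = (size h).+2 by rewrite fE size_Mmonic ?monicXn ?monic_neq0 // size_polyXn addnS addn2.
rewrite (eq_big_seq (fun P => legendre h P)) => [|P /primes_of_degreeP[Pm Pi sP]].
  apply: IH => //; last by move: sf; rewrite sh => /ltnW/ltnW.
  - by move: hk; rewrite sh ltnS => /ltnW.
  - by move=> e he; apply: (fns (e * 'X)); rewrite exprMn -he.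
rewrite fE legendreM // legendre_sqr ?mulr1 //.
apply/negP => /(dvdp_leq (_ : 'X != 0)); rewrite polyX_eq0 => /(_ isT).
by rewrite size_polyX sP; lia.
Qed.

End CharacterSum.

(** * Pairs with square product *)

Section SquarePairs.
Variable F : finFieldType.
Local Notation q := #|F|.
Implicit Types a b d f h l : {poly F}.

Definition pairs k : seq ({poly F} * {poly F}) :=
  flatten [seq [seq (f, h) | f <- mon F i, h <- mon F (k - i)] | i <- iota 0 k.+1].

Lemma mem_pairs k f h :
  ((f, h) \in pairs k) = [&& f \is monic, h \is monic & (size f + size h == k.+2)%N].
Proof.
apply/flatten_mapP/and3P => [[i]|[fm hm /eqP sfh]].
  rewrite mem_iota add0n ltnS /= => ik /allpairsP[[f' h'] /= [/monP[fm sf _] /monP[hm sh _] [-> ->]]].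
  by split=> //; rewrite sf sh addSn addnS subnKC.
have sf : size f = (size f).-1.+1 by rewrite prednK // size_poly_gt0 monic_neq0.
have sh : size h = (size h).-1.+1 by rewrite prednK // size_poly_gt0 monic_neq0.
exists (size f).-1; first by rewrite mem_iota add0n /=; move: sfh; rewrite sf sh; lia.
apply/allpairsP; exists (f, h); split=> //=; rewrite mem_mon ?fm ?hm /=; first by apply/eqP.
by apply/eqP; move: sfh; rewrite sf sh /=; lia.
Qed.

Lemma pairs_uniq k : uniq (pairs k).
Proof.
apply: uniq_flatten_map => [|i|i j x]; first exact: iota_uniq.
  by apply: allpairs_uniq; rewrite ?mon_uniq // => -[? ?] [? ?] _ _ [-> ->].
case/allpairsP => [[f h] /= [/monP[_ sf _] _ ->]].
by case/allpairsP => [[f' h'] /= [/monP[_ sf' _] _ [e _]]]; move: sf; rewrite e sf' => -[].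
Qed.

Lemma sum_pairs (V : nmodType) k (G : {poly F} * {poly F} -> V) :
  \sum_(p <- pairs k) G p =
  \sum_(i < k.+1) \sum_(f <- mon F i) \sum_(h <- mon F (k - i)) G (f, h).
Proof.
rewrite big_flatten big_map -[iota 0 _]/(index_iota 0 k.+1) big_mkord.
by apply: eq_bigr => i _; rewrite big_allpairs_dep.
Qed.

Lemma size_pairs k : size (pairs k) = (k.+1 * q ^ k)%N.
Proof.
rewrite -sum1_size sum_pairs (eq_bigr (fun=> (q ^ k)%N)) => [|i _].
  by rewrite sum_nat_const card_ord.
rewrite (eq_bigr (fun=> (q ^ (k - i))%N)) => [|f _]; last by rewrite sum1_size size_mon.
by rewrite big_const_seq count_predT size_mon iter_addn_0 mulnC -expnD subnKC // -ltnS.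
Qed.

Definition coprime_pairs k := [seq p <- pairs k | coprimep p.1 p.2].

Lemma mem_coprime_pairs k f h : ((f, h) \in coprime_pairs k) =
  [&& coprimep f h, f \is monic, h \is monic & (size f + size h == k.+2)%N].
Proof. by rewrite mem_filter mem_pairs. Qed.

Definition triples (K : nat -> nat) M : seq ({poly F} * ({poly F} * {poly F})) :=
  flatten [seq [seq (d, p) | d <- mon F i, p <- coprime_pairs (K i)] | i <- iota 0 M].

Lemma size_triples K M :
  size (triples K M) = (\sum_(i < M) q ^ i * size (coprime_pairs (K i)))%N.
Proof.
rewrite -sum1_size big_flatten big_map -{1}[M]subn0 -/(index_iota 0 M) big_mkord.
by apply: eq_bigr => i _; rewrite sum1_size size_allpairs size_mon.
Qed.

Lemma mem_triples K M d p :
  ((d, p) \in triples K M) =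
  [&& d \is monic, ((size d).-1 < M)%N & p \in coprime_pairs (K (size d).-1)].
Proof.
apply/flatten_mapP/and3P => [[i]|[dm dM pK]].
  rewrite mem_iota add0n /= => iM /allpairsP[[d' p'] /= [/monP[dm sd _] pK [-> ->]]].
  by rewrite sd.
exists (size d).-1; first by rewrite mem_iota.
apply/allpairsP; exists (d, p); split=> //=.
by rewrite mem_mon dm prednK ?eqxx // size_poly_gt0 monic_neq0.
Qed.

Lemma triples_uniq K M : uniq (triples K M).
Proof.
apply: uniq_flatten_map => [|i|i j x]; first exact: iota_uniq.
  by apply: allpairs_uniq; rewrite ?mon_uniq ?filter_uniq ?pairs_uniq // => -[? ?] [? ?] _ _ [-> ->].
case/allpairsP => [[f h] /= [/monP[_ sf _] _ ->]].
by case/allpairsP => [[f' h'] /= [/monP[_ sf' _] _ [e _]]]; move: sf; rewrite e sf' => -[].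
Qed.

Lemma monic_expI e a b : (0 < e)%N -> a \is monic -> b \is monic -> a ^+ e = b ^+ e -> a = b.
Proof.
move=> e0 am bm h; apply/eqP; rewrite -eqp_monic //.
by rewrite /eqp -(dvdp_pexp2r a b e0) -(dvdp_pexp2r b a e0) h dvdpp.
Qed.

Lemma gcd_scaled d a b e : coprimep a b -> gcdp (d * a ^+ e) (d * b ^+ e) %= d.
Proof.
move=> cop; apply: eqp_trans (gcdp_mul2l _ _ _) _.
have g1 : gcdp (a ^+ e) (b ^+ e) %= 1.
  by rewrite -size_poly_eq1 -coprimep_def coprimep_expl // coprimep_expr.
by rewrite -[X in _ %= X]mulr1 eqp_mull.
Qed.

(** With d the gcd of the result, e = 1 reaches all pairs and e = 2 the pairs with square
    product. *)
Definition recombine e (t : {poly F} * ({poly F} * {poly F})) :=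
  (t.1 * t.2.1 ^+ e, t.1 * t.2.2 ^+ e).

Lemma recombine_inj e K M : (0 < e)%N -> {in triples K M &, injective (recombine e)}.
Proof.
move=> e0 [d [a b]] [d' [a' b']]; rewrite !mem_triples !mem_coprime_pairs.
move=> /and3P[dm _ /and4P[cop am bm _]] /and3P[dm' _ /and4P[cop' am' bm' _]] [ea eb].
have dd : d = d'.
  apply/eqP; rewrite -eqp_monic //; apply: eqp_trans (gcd_scaled d' e cop').
  by rewrite -ea -eb eqp_sym gcd_scaled.
have d0 := monic_neq0 dm; move: ea eb; rewrite -dd => /(mulfI d0) ea /(mulfI d0) eb.
by rewrite (monic_expI e0 am am' ea) (monic_expI e0 bm bm' eb).
Qed.

Lemma size_perm_recombine e K M (s : seq ({poly F} * {poly F})) : (0 < e)%N -> uniq s ->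
  (forall t, t \in triples K M -> recombine e t \in s) ->
  (forall p, p \in s -> exists2 t, t \in triples K M & p = recombine e t) ->
  size s = (\sum_(i < M) q ^ i * size (coprime_pairs (K i)))%N.
Proof.
move=> e0 us sub sur; rewrite -size_triples -(size_map (recombine e)).
apply: perm_size; apply: uniq_perm => // [|p].
  by rewrite map_inj_in_uniq ?triples_uniq //; apply: recombine_inj.
by apply/idP/mapP => [/sur|[t /sub h ->]].
Qed.

Lemma monic_gcdp f h : f != 0 -> exists2 d, d \is monic & d %= gcdp f h.
Proof.
move=> f0; have g0 : gcdp f h != 0 by rewrite gcdp_eq0 (negPf f0).
exists ((lead_coef (gcdp f h))^-1 *: gcdp f h).
  by rewrite monicE lead_coefZ mulVf // lead_coef_eq0.
by rewrite eqp_scale // invr_eq0 lead_coef_eq0.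
Qed.

Lemma coprime_decomposition f h : f \is monic -> h \is monic -> exists d a b,
  [/\ d \is monic, a \is monic, b \is monic, coprimep a b & f = d * a /\ h = d * b].
Proof.
move=> fm hm; have f0 := monic_neq0 fm; have h0 := monic_neq0 hm.
have [d dm dg] := monic_gcdp h f0.
have /dvdpP[a fE] : d %| f by rewrite (eqp_dvdl _ dg) dvdp_gcdl.
have /dvdpP[b hE] : d %| h by rewrite (eqp_dvdl _ dg) dvdp_gcdr.
exists d, a, b; split=> //.
- by rewrite -(monicMr a dm) -fE.
- by rewrite -(monicMr b dm) -hE.
- have d0 := monic_neq0 dm; rewrite coprimep_def size_poly_eq1.
  rewrite -(eqp_mul2l _ _ d0) mulr1 eqp_sym; apply: eqp_trans dg _.
  by rewrite fE hE ![_ * d]mulrC gcdp_mul2l.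
- by rewrite fE hE ![_ * d]mulrC.
Qed.

Lemma size_mul_monic a b : a \is monic -> b \is monic ->
  (size (a * b)%R).+1 = (size a + size b)%N.
Proof.
move=> am bm; rewrite size_Mmonic ?monic_neq0 // prednK // addn_gt0.
by rewrite size_poly_gt0 monic_neq0.
Qed.

Lemma size_pairs_gcd k :
  size (pairs k) = (\sum_(i < k./2.+1) q ^ i * size (coprime_pairs (k - 2 * i)))%N.
Proof.
apply: (@size_perm_recombine 1 (fun i => k - 2 * i)%N) => // [|[d [a b]]|[f h]]; first exact: pairs_uniq.
  rewrite mem_triples mem_coprime_pairs mem_pairs /= !expr1.
  case/and3P => dm dk /and4P[cop am bm /eqP sab]; rewrite !monicMr ?dm ?am ?bm //=.
  have := size_mul_monic dm am; have := size_mul_monic dm bm.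
  have : (0 < size d)%N by rewrite size_poly_gt0 monic_neq0.
  move: (size (d * a)%R) (size (d * b)%R) (size d) (size a) (size b) dk sab => x y z u w; lia.
rewrite mem_pairs => /and3P[fm hm /eqP sfh].
have [d [a [b [dm am bm cop [fE hE]]]]] := coprime_decomposition fm hm.
exists (d, (a, b)); last by rewrite /recombine !expr1 -fE -hE.
rewrite mem_triples mem_coprime_pairs dm am bm cop /=.
have := size_mul_monic dm am; have := size_mul_monic dm bm; rewrite -fE -hE.
have : (0 < size d)%N by rewrite size_poly_gt0 monic_neq0.
have : (0 < size a)%N by rewrite size_poly_gt0 monic_neq0.
have : (0 < size b)%N by rewrite size_poly_gt0 monic_neq0.
move: (size f) (size h) (size d) (size a) (size b) sfh => x y z u w; lia.
Qed.

(** Let d be the gcd of f and l, f = d f1, l = d l1. Then f1 h = d l1^2, where f1 is coprime to l1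
    and d to h, so f1 and d divide each other. No factorisation into primes is needed. *)
Lemma coprime_square f h l : f \is monic -> coprimep f h -> f * h = l ^+ 2 ->
  exists2 a, a \is monic & f = a ^+ 2.
Proof.
move=> fm cop e; have f0 := monic_neq0 fm.
have [d dm dg] := monic_gcdp l f0.
have d0 := monic_neq0 dm.
have df : d %| f by rewrite (eqp_dvdl _ dg) dvdp_gcdl.
have dl : d %| l by rewrite (eqp_dvdl _ dg) dvdp_gcdr.
have /dvdpP[f1 fE] := df; have /dvdpP[l1 lE] := dl.
have cfl : coprimep f1 l1.
  rewrite coprimep_def size_poly_eq1 -(eqp_mul2l _ _ d0) mulr1 eqp_sym; apply: eqp_trans dg _.
  by rewrite fE lE ![_ * d]mulrC gcdp_mul2l.
have e1 : f1 * h = d * l1 ^+ 2.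
  apply: (mulfI d0); rewrite mulrA [d * f1]mulrC -fE e lE; ring.
have f1d : f1 %| d.
  by rewrite -(Gauss_dvdpl _ (coprimep_expr 2 cfl)) -e1 dvdp_mulr.
have df1 : d %| f1.
  by rewrite -(Gauss_dvdpl _ (coprimep_dvdr df cop)) e1 dvdp_mulr.
exists d => //; apply/eqP; rewrite -eqp_monic ?monic_exp //.
by rewrite fE expr2 eqp_mul2r // /eqp f1d df1.
Qed.

Definition is_square f : bool := pbool (exists l, f = l ^+ 2).
Definition square_pairs k := [seq p <- pairs k | is_square (p.1 * p.2)].

(** Divided by their gcd d, f and h become coprime with square product, hence squares a^2 and b^2,
    and deg a + deg b = m - deg d. *)
Lemma size_square_pairs m :
  size (square_pairs (2 * m)) = (\sum_(i < m.+1) q ^ i * size (coprime_pairs (m - i)))%N.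
Proof.
apply: (@size_perm_recombine 2 (fun i => m - i)%N) => // [|[d [a b]]|[f h]]; first by rewrite filter_uniq ?pairs_uniq.
  rewrite mem_triples mem_coprime_pairs mem_filter mem_pairs /=.
  case/and3P => dm dk /and4P[cop am bm /eqP sab].
  have [a2 b2] : a ^+ 2 \is monic /\ b ^+ 2 \is monic by rewrite !monic_exp.
  rewrite !monicMr ?dm ?a2 ?b2 //=; apply/andP; split.
    by apply/pboolP; exists (d * a * b); ring.
  have := size_mul_monic dm a2; have := size_mul_monic dm b2; have := size_mul_monic am am; have := size_mul_monic bm bm.
  rewrite -!expr2; have : (0 < size d)%N by rewrite size_poly_gt0 monic_neq0.
  move: (size (d * _)%R) (size (d * _)%R) (size (a ^+ 2)%R) (size (b ^+ 2)%R) (size d) (size a) (size b) dk sab.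
  by move=> x y z u w v t; lia.
rewrite mem_filter mem_pairs => /andP[/pboolP[l /= lE] /and3P[fm hm /eqP sfh]].
have [d [f' [h' [dm f'm h'm cop [fE hE]]]]] := coprime_decomposition fm hm.
have /dvdpP[l' l'E] : d %| l.
  by rewrite -(@dvdp_pexp2r _ _ _ 2) // -lE fE hE expr2 mulrACA dvdp_mulr.
have e : f' * h' = l' ^+ 2.
  apply: (mulfI (expf_neq0 2 (monic_neq0 dm))).
  by rewrite expr2 mulrACA -fE -hE lE l'E exprMn mulrC expr2.
have [a am aE] := coprime_square f'm cop e.
have cop' : coprimep h' f' by rewrite coprimep_sym.
have [b bm bE] := coprime_square h'm cop' (etrans (mulrC _ _) e).
exists (d, (a, b)); last by rewrite /recombine /= -aE -bE -fE -hE.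
have cab : coprimep a b by move: cop; rewrite aE bE coprimep_pexpl // coprimep_pexpr.
rewrite mem_triples mem_coprime_pairs dm am bm cab /=.
have := size_mul_monic dm f'm; have := size_mul_monic dm h'm; rewrite -fE -hE aE bE.
have := size_mul_monic am am; have := size_mul_monic bm bm; rewrite -!expr2.
have : (0 < size d)%N by rewrite size_poly_gt0 monic_neq0.
have : (0 < size a)%N by rewrite size_poly_gt0 monic_neq0.
have : (0 < size b)%N by rewrite size_poly_gt0 monic_neq0.
move: (size f) (size h) (size (a ^+ 2)%R) (size (b ^+ 2)%R) (size d) (size a) (size b) sfh.
by move=> x y z u w v t; lia.
Qed.

(** Subtracting q times [size_pairs_gcd] for k - 1 from the case k + 1 leaves only the term with
    trivial gcd. The generating series is (1 - q v^2)/(1 - q v)^2. *)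
Lemma coprime_pairs_rec k :
  (size (coprime_pairs k.+1) + k * q ^ k = k.+2 * q ^ k.+1)%N.
Proof.
have := size_pairs_gcd k.+1; rewrite size_pairs big_ord_recl expn0 mul1n subn0 => ->.
congr addn; case: k => [|k]; first by rewrite big_ord0.
have -> : k.+2./2 = k./2.+1 by [].
transitivity (q * size (pairs k))%N; first by rewrite size_pairs expnS mulnCA.
rewrite size_pairs_gcd big_distrr; apply: eq_bigr => i _ /=.
by rewrite mulnA -expnS; congr (_ * size (coprime_pairs _))%N; rewrite /bump; lia.
Qed.

(** The generating series is (1 - q v^2)/(1 - q v)^3; denominators and the subtracted term are
    cleared to stay in the natural numbers. *)
Lemma size_square_pairs_closed m :
  (2 * q * size (square_pairs (2 * m)) + q ^ m * (m * m.-1) = q ^ m.+1 * (m.+1 * m.+2))%N.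
Proof.
have qS k : size (square_pairs (2 * k.+1)) =
    (size (coprime_pairs k.+1) + q * size (square_pairs (2 * k)))%N.
  rewrite !size_square_pairs big_ord_recl expn0 mul1n subn0; congr addn.
  by rewrite big_distrr; apply: eq_bigr => i _ /=; rewrite mulnA -expnS.
elim: m => [|m IH].
  rewrite size_square_pairs big_ord1 expn0 !mul1n.
  have := size_pairs_gcd 0; rewrite size_pairs big_ord1 !expn0 !mul1n => <-.
  by rewrite muln0 addn0 expn1; lia.
rewrite qS; have := coprime_pairs_rec m; move: IH; rewrite !expnS /=.
move: (size _) (size _) (q ^ m)%N (q) => a b x y; case: m => [|m]; nia.
Qed.

End SquarePairs.

(** * The second moment *)

Lemma sum_triangle (V : nmodType) (G : nat -> nat -> V) M :
  \sum_(i < M) \sum_(j < M - i) G i j = \sum_(k < M) \sum_(i < k.+1) G i (k - i)%N.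
Proof.
elim: M => [|M IH]; first by rewrite !big_ord0.
rewrite [RHS]big_ord_recr /= -IH [LHS]big_ord_recr /= [X in _ = _ + X]big_ord_recr /=.
rewrite subSnn big_ord1 subnn addrA; congr (_ + _).
rewrite -big_split /=; apply: eq_bigr => i _.
by rewrite subSn ?big_ord_recr //= ltnW.
Qed.

(** Pairs with i + j > N are reflected to (N - i, N - j), of total degree below N; the two factors e
    cancel. *)
Lemma sqr_sum_symmetric (A : comPzRingType) (x : nat -> A) (e : A) N : e * e = 1 ->
  (forall j, (j <= N)%N -> x (N - j)%N = e * x j) ->
  (\sum_(j < N.+1) x j) ^+ 2 =
    \sum_(k < N.+1) \sum_(i < k.+1) x i * x (k - i)%N
    + \sum_(k < N) \sum_(i < k.+1) x i * x (k - i)%N.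
Proof.
move=> ee sym; rewrite -!(sum_triangle (fun i j => x i * x j)) expr2 mulr_suml.
rewrite (eq_bigr (fun i : 'I_N.+1 => \sum_(j < N.+1 | (i + j <= N)%N) x i * x j
   + \sum_(j < N.+1 | ~~ (i + j <= N)%N) x i * x j)); last first.
  by move=> i _; rewrite mulr_sumr [LHS](bigID (fun j : 'I__ => i + j <= N)%N).
rewrite big_split /=; congr (_ + _).
  apply: eq_bigr => i _; rewrite (big_ord_widen N.+1 (fun j => x i * x j)) ?leq_subr //.
  by apply: eq_bigl => j; have := ltn_ord i; lia.
rewrite (reindex_inj rev_ord_inj) /= big_ord_recr /= [X in _ + X]big1 ?addr0; last first.
  by move=> j; have := ltn_ord j; lia.
apply: eq_bigr => i _; have iN := ltn_ord i.
rewrite (reindex_inj rev_ord_inj) /= (big_ord_widen N.+1 (fun j => x i * x j)); last by lia.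
apply: eq_big => [j|j _]; have jN := ltn_ord j; first by rewrite !subSS; lia.
rewrite !subSS !sym; [|lia|lia].
by rewrite mulrACA ee mul1r.
Qed.

Lemma sumr_const_seq (V : nmodType) (I : Type) (s : seq I) (x : V) :
  \sum_(i <- s) x = x *+ size s.
Proof. by rewrite big_const_seq count_predT iter_addr_0. Qed.

Section Moment.
Variables (R : rcfType) (F : finFieldType).
Local Notation q := #|F|.
Hypotheses (oq : odd q) (q4 : (q %% 4 = 1)%N).

Lemma q_ge5 : (5 <= q)%N.
Proof. by have := card_gt1 F; lia. Qed.

Local Notation s := (Num.sqrt (qR F R)).

Lemma qR_gt0 : 0 < qR F R.
Proof. by rewrite ltr0n; have := q_ge5; lia. Qed.

Lemma sqr_s : s ^+ 2 = qR F R.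
Proof. by rewrite sqr_sqrtr // ltW // qR_gt0. Qed.

Lemma s_gt0 : 0 < s.
Proof. by rewrite sqrtr_gt0 qR_gt0. Qed.

Lemma s_neq0 k : s ^+ k != 0.
Proof. by rewrite expf_neq0 // gt_eqF // s_gt0. Qed.

Lemma Lhalf_Acoef g P : P \in primes_of_degree F (2 * g + 1) ->
  Lhalf R P = \sum_(j < (2 * g).+1) (Acoef P j)%:~R / s ^+ j.
Proof.
move=> /primes_of_degreeP[Pm Pi sP]; rewrite /Lhalf sP addn1 /=.
apply: eq_bigr => j _; congr (_ / _).
rewrite (sum_mon j xpredT (fun f => (chi P f)%:~R)) /Acoef rmorph_sum /=.
by apply: eq_big_seq => f /monP[fm _ _]; rewrite /chi jacobi_legendre.
Qed.

Lemma Acoef_convolution g P k : P \in primes_of_degree F (2 * g + 1) ->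
  \sum_(i < k.+1) Acoef P i * Acoef P (k - i) = \sum_(p <- pairs F k) legendre (p.1 * p.2) P.
Proof.
move=> /primes_of_degreeP[Pm Pi sP]; rewrite sum_pairs; apply: eq_bigr => i _.
rewrite mulr_suml; apply: eq_bigr => f _; rewrite mulr_sumr.
by apply: eq_bigr => h _; rewrite legendreM.
Qed.

Lemma Lhalf_sqr g P : P \in primes_of_degree F (2 * g + 1) ->
  Lhalf R P ^+ 2 =
    \sum_(k < (2 * g).+1) (\sum_(p <- pairs F k) legendre (p.1 * p.2) P)%:~R / s ^+ k
  + \sum_(k < 2 * g) (\sum_(p <- pairs F k) legendre (p.1 * p.2) P)%:~R / s ^+ k.
Proof.
move=> Pin; have [Pm Pi sP] := primes_of_degreeP Pin.
have on : odd (size P).-1 by rewrite sP /=; lia.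
have fe j : (j <= 2 * g)%N -> Acoef P (2 * g) ^+ 2 = (q ^ (2 * g))%:R /\
    Acoef P (2 * g) * Acoef P j = (q ^ j)%:R * Acoef P (2 * g - j).
  move=> hj; have := @functional_equation F P oq Pm Pi on j; rewrite sP addn1 /=; exact.
(* In this normalisation the functional equation is a symmetry with sign x (2g), whose square is
   1. *)
pose x j := (Acoef P j)%:~R / s ^+ j : R.
have s2 j : s ^+ j * s ^+ j = (q ^ j)%:R by rewrite -exprMn -expr2 sqr_s natrX.
have xE : x (2 * g)%N * x (2 * g)%N = 1.
  have [e _] := fe 0%N (leq0n _).
  by rewrite /x mulrACA -intrM -expr2 e -invfM s2 rmorph_nat divff // -s2 mulf_neq0 ?s_neq0.
have sym j : (j <= 2 * g)%N -> x (2 * g - j)%N = x (2 * g)%N * x j.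
  move=> hj; have [_ e] := fe j hj; rewrite /x mulrACA -intrM e intrM rmorph_nat -s2.
  have -> : s ^+ (2 * g) = s ^+ (2 * g - j) * s ^+ j by rewrite -exprD subnK.
  have := s_neq0 j; have := s_neq0 (2 * g - j).
  by move: (s ^+ _) (s ^+ _) => a b a0 b0; field; rewrite a0 b0.
rewrite (Lhalf_Acoef Pin) (sqr_sum_symmetric xE sym).
have conv k : \sum_(i < k.+1) x i * x (k - i)%N =
    (\sum_(p <- pairs F k) legendre (p.1 * p.2) P)%:~R / s ^+ k.
  rewrite -(Acoef_convolution _ Pin) rmorph_sum mulr_suml /=; apply: eq_bigr => i _.
  by rewrite /x mulrACA -intrM -invfM -exprD subnKC // -ltnS.
by congr (_ + _); apply: eq_bigr => k _; rewrite conv.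
Qed.

Definition twisted_sum g k : int :=
  \sum_(p <- pairs F k) \sum_(P <- primes_of_degree F (2 * g + 1)) legendre (p.1 * p.2) P.

Lemma second_momentE g : second_moment F R g =
    \sum_(k < (2 * g).+1) (twisted_sum g k)%:~R / s ^+ k
  + \sum_(k < 2 * g) (twisted_sum g k)%:~R / s ^+ k.
Proof.
rewrite /second_moment (sum_mon (2 * g + 1) (@irredb F) (fun P => Lhalf R P ^+ 2)) -big_filter.
rewrite (eq_big_seq _ (@Lhalf_sqr g)) big_split /= exchange_big /= [X in _ + X]exchange_big /=.
have ex k : \sum_(P <- primes_of_degree F (2 * g + 1))
    (\sum_(p <- pairs F k) legendre (p.1 * p.2) P)%:~R / s ^+ k = (twisted_sum g k)%:~R / s ^+ k.
  by rewrite -mulr_suml -rmorph_sum /= /twisted_sum exchange_big.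
by congr (_ + _); apply: eq_bigr => k _; rewrite ex.
Qed.

(** As deg (f h) <= 2g < deg P, no P divides f h: square pairs contribute 1 for every prime, and
    [char_sum_bound] covers the others. *)
Lemma twisted_sum_bound g k : (0 < g)%N -> (k <= 2 * g)%N ->
  `|twisted_sum g k - (size (primes_of_degree F (2 * g + 1)) * size (square_pairs F k))%:R|
    <= (k.+1 * q ^ k * (5 * q ^ g.+1))%:R.
Proof.
move=> g0 hk; rewrite /twisted_sum (bigID (fun p => is_square (p.1 * p.2))) /=.
have sz p : p \in pairs F k -> [/\ p.1 * p.2 \is monic & (size (p.1 * p.2)%R <= 2 * g + 1)%N].
  case: p => f h; rewrite mem_pairs => /and3P[fm hm /eqP sfh].
  have := size_mul_monic fm hm; rewrite sfh => -[->]; split; first by rewrite monicMr.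
  by rewrite addn1 ltnS.
rewrite [X in X + _ - _](_ : _ = (size (primes_of_degree F (2 * g + 1)) * size (square_pairs F k))%:R).
  rewrite addrAC subrr add0r; apply: le_trans (ler_norm_sum _ _ _) _.
  rewrite -size_pairs natrM mulr_natl -[X in _ <= X]sumr_const_seq.
  rewrite [X in X <= _]big_mkcond /=; rewrite big_seq [X in _ <= X]big_seq.
  apply: ler_sum => p pk; case: ifP => // ns; have [fm sf] := sz p pk.
  apply: char_sum_bound => //; first exact: q_ge5.
  by move=> e fe; move/negP: ns; apply; apply/pboolP; exists e.
rewrite -big_filter -/(square_pairs F k) natrM mulr_natr.
rewrite -[in RHS](sumr_const_seq (square_pairs F k) (size _)%:R).
apply: eq_big_seq => p; rewrite mem_filter => /andP[/pboolP[l lE] /sz[fm sf]].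
rewrite (eq_big_seq (fun=> 1)) => [|P /primes_of_degreeP[Pm Pi sP]].
  by rewrite big_const_seq count_predT iter_addr_0.
rewrite lE legendre_sqr //; apply/negP => d; have : P %| p.1 * p.2 by rewrite lE expr2 dvdp_mulr.
by move/(dvdp_leq (monic_neq0 fm)); rewrite sP leqNgt ltnS sf.
Qed.

(** * Density of the square pairs and the final estimates *)

Lemma square_pairs_odd m : size (square_pairs F (2 * m + 1)) = 0%N.
Proof.
apply/eqP; rewrite size_eq0; apply/eqP; apply/nilP; rewrite /nilp size_filter -leqn0 leqNgt -has_count.
apply/hasPn => -[f h] /=; rewrite mem_pairs => /and3P[fm hm /eqP sfh].
apply/negP => /pboolP[l lE].
have := size_mul_monic fm hm; rewrite sfh lE => -[].
have := size_exp l 2; move: (size (l ^+ 2)%R) => x hx hx'; move: hx; rewrite hx' /=; lia.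
Qed.

Lemma sum_even (a : nat -> R) G : (forall m, a (2 * m + 1)%N = 0) ->
  \sum_(k < 2 * G) a k = \sum_(m < G) a (2 * m)%N.
Proof.
move=> odd0; elim: G => [|G IH]; first by rewrite !big_ord0.
have -> : (2 * G.+1 = (2 * G).+2)%N by lia.
by rewrite !big_ord_recr /= IH -[(2 * G).+1]addn1 odd0 addr0.
Qed.

Definition square_density k : R := (size (square_pairs F k))%:R / s ^+ k.

Lemma square_density_odd m : square_density (2 * m + 1) = 0.
Proof. by rewrite /square_density square_pairs_odd mul0r. Qed.

Lemma square_density_even m :
  square_density (2 * m) = ((m%:R + 1) * (m%:R + 2) - m%:R * (m%:R - 1) / qR F R) / 2.
Proof.
have := congr1 (fun x => x%:R : R) (size_square_pairs_closed F m).
rewrite /square_density exprM sqr_s !natrD !natrM !natrX -/(qR F R) exprS.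
have -> : m.+1%:R = m%:R + 1 :> R by rewrite natr1.
have -> : m.+2%:R = m%:R + 2 :> R by rewrite -natrD addn2.
have -> : m%:R * (m.-1)%:R = m%:R * (m%:R - 1) :> R.
  by case: m => [|m]; rewrite ?mul0r //= -[X in _ = _ * (X - 1)]natr1 addrK.
have q0 : qR F R != 0 by rewrite gt_eqF ?qR_gt0.
have Q0 : qR F R ^+ m != 0 by rewrite expf_neq0.
move: (size _)%:R (qR F R ^+ m) Q0 m%:R => x Y Y0 t; move: (qR F R) q0 => y y0 e.
have -> : x = (y * Y * ((t + 1) * (t + 2)) - Y * (t * (t - 1))) / (2 * y).
  rewrite -e addrK [2 * y * x]mulrC mulfK // mulf_neq0 // pnatr_eq0 //.
by field; rewrite y0 Y0.
Qed.

Lemma sum_square_density G : \sum_(m < G) square_density (2 * m) =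
  (G%:R * (G%:R + 1) * (G%:R + 2) - G%:R * (G%:R - 1) * (G%:R - 2) / qR F R) / 6.
Proof.
have q0 : qR F R != 0 by rewrite gt_eqF ?qR_gt0.
elim: G => [|G IH]; first by rewrite big_ord0 !mul0r subrr mul0r.
rewrite big_ord_recr /= IH square_density_even.
have -> : G.+1%:R = G%:R + 1 :> R by rewrite natr1.
by field.
Qed.

Lemma geometric_bound M : \sum_(k < M) s ^+ k <= s ^+ M.
Proof.
have s2 : 2 <= s.
  rewrite -(@ler_pXn2r _ 2) ?nnegrE ?ler0n ?sqrtr_ge0 // sqr_s /qR -natrX ler_nat.
  by have := q_ge5; lia.
elim: M => [|M IH]; first by rewrite big_ord0 ler01.
rewrite big_ord_recr exprS /=; have := exprn_gt0 M s_gt0.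
by move: (\sum_(_ < _) _) (s ^+ M) IH => x y; nra.
Qed.

(** Divided by s^k, the bound for degree k grows like s^k, so the geometric sum is at most s^M <=
    s^(N+1) = q^(g+1). *)
Lemma error_bound g (N := (2 * g + 1)%N) M : (0 < g)%N -> (M <= N)%N ->
  `|\sum_(k < M) (twisted_sum g k)%:~R / s ^+ k
     - (size (primes_of_degree F N))%:R * \sum_(k < M) square_density k|
   <= 5 * N%:R * qR F R * qR F R ^+ N.
Proof.
move=> g0 MN; rewrite mulr_sumr -sumrB; apply: le_trans (ler_norm_sum _ _ _) _.
have qp : 0 <= qR F R ^+ g.+1 by rewrite exprn_ge0 // ltW // qR_gt0.
apply: (@le_trans _ _ (\sum_(k < M) (5 * N%:R * qR F R ^+ g.+1) * s ^+ k)).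
  apply: ler_sum => k _; have kM := ltn_ord k; have kg : (k <= 2 * g)%N by rewrite /N in MN; lia.
  have := twisted_sum_bound g0 kg; rewrite -/N -(ler_int R) intr_norm rmorphB /= !rmorph_nat.
  rewrite /square_density mulrA -mulrBl normrM normfV [`|s ^+ k|]ger0_norm; last first.
    by rewrite exprn_ge0 // ltW // s_gt0.
  rewrite ler_pdivrMr ?exprn_gt0 ?s_gt0 // => h.
  have kN : (k.+1 <= N)%N by rewrite (leq_trans kM).
  rewrite natrM in h; apply: le_trans h _.
  rewrite !natrM !natrX -/(qR F R) -[X in _ <= X]mulrA -exprMn -expr2 sqr_s.
  have -> : k.+1%:R * qR F R ^+ k * (5 * qR F R ^+ g.+1) = k.+1%:R * (5 * qR F R ^+ g.+1 * qR F R ^+ k) by ring.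
  have -> : 5 * N%:R * qR F R ^+ g.+1 * qR F R ^+ k = N%:R * (5 * qR F R ^+ g.+1 * qR F R ^+ k) by ring.
  by rewrite ler_wpM2r ?ler_nat // !mulr_ge0 // exprn_ge0 // ltW // qR_gt0.
rewrite -mulr_sumr.
have e : qR F R * qR F R ^+ N = qR F R ^+ g.+1 * s ^+ N.+1.
  have -> : N.+1 = (2 * g.+1)%N by rewrite /N; lia.
  by rewrite exprM sqr_s -exprD -exprS; congr (_ ^+ _); rewrite /N; lia.
rewrite -[X in _ <= X]mulrA e mulrA ler_wpM2l ?mulr_ge0 //.
have s1 : 1 <= s.
  by rewrite -(@ler_pXn2r _ 2) ?nnegrE ?ler01 ?sqrtr_ge0 // expr1n sqr_s ler1n; have := q_ge5; lia.
apply: le_trans (geometric_bound M) _.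
by rewrite ler_weXn2l // ltnW.
Qed.

Lemma main_term_bound g (n := (2 * g + 1)%N) (x := qR F R ^+ n) :
  `|(size (primes_of_degree F n))%:R *
      (\sum_(k < (2 * g).+1) square_density k + \sum_(k < 2 * g) square_density k)
    - 1 / 24 * (1 / zetaA2 F R) * x * n%:R ^+ 2| <= 3 * x * n%:R.
Proof.
have q0 : qR F R != 0 by rewrite gt_eqF ?qR_gt0.
(* Even degrees 2m with m <= g and with m < g give [sum_square_density] at g + 1 and at g;
   substituting g = (n-1)/2 turns the denominator 6 into 24. *)
have dE : \sum_(k < (2 * g).+1) square_density k + \sum_(k < 2 * g) square_density k =
    ((n%:R + 1) * (n%:R + 2) * (n%:R + 3)
      - (n%:R - 1) * (n%:R - 2) * (n%:R - 3) / qR F R) / 24.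
  rewrite big_ord_recr /= !(sum_even _ square_density_odd) -[X in X + _](big_ord_recr g (fun m => square_density (2 * m))) /=.
  rewrite !sum_square_density /n natrD natrM.
  have -> : g.+1%:R = g%:R + 1 :> R by rewrite natr1.
  by field.
rewrite dE; have -> : 1 / zetaA2 F R = 1 - (qR F R)^-1 by rewrite /zetaA2 div1r invrK.
set pi : R := (size _)%:R.
have n1 : 1 <= n%:R :> R by rewrite ler1n /n addn1.
have qX k : qR F R ^+ k = (q ^ k)%:R by rewrite natrX.
have up : pi * n%:R <= x.
  by rewrite /x qX /pi -natrM ler_nat prime_count_upper // /n addn1.
have lo : x <= pi * n%:R + qR F R ^+ g.+1.
  by rewrite /x !qX /pi -natrM -natrD ler_nat prime_count_lower.
have nx : n%:R * qR F R ^+ g.+1 <= x.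
  have -> : x = qR F R ^+ g * qR F R ^+ g.+1 by rewrite -exprD; congr (_ ^+ _); rewrite /n; lia.
  apply: ler_wpM2r; first by rewrite exprn_ge0 ?ltW ?qR_gt0.
  rewrite qX ler_nat /n.
  elim: (g) => // k IH; rewrite expnS; have := q_ge5; move: IH; move: (q ^ k)%N (q) => y z; nia.
have iq : 0 < (qR F R)^-1 <= 1.
  by rewrite invr_gt0 qR_gt0 invf_le1 ?qR_gt0 // ler1n; have := q_ge5; lia.
have pi0 : 0 <= pi by rewrite ler0n.
move: nx lo up iq; move: (qR F R ^+ g.+1) (qR F R)^-1 => r v.
move: n%:R n1 x => t t1 x nx lo up /andP[v0 v1].
(* A is the cost of replacing pi t by x, B collects the lower terms of the cubic; its constant is 35
   = 12 + 11 + 12, as v <= 1 <= t. *)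
pose A := (1 - v) * t ^+ 2 * (x - pi * t).
pose B := pi * (6 * t ^+ 2 * (1 + v) + 11 * t * (1 - v) + 6 * (1 + v)).
have -> : pi * (((t + 1) * (t + 2) * (t + 3) - (t - 1) * (t - 2) * (t - 3) * v) / 24)
    - 1 / 24 * (1 - v) * x * t ^+ 2 = (B - A) / 24 by rewrite /A /B; field.
have t2 : t <= t ^+ 2 by nra.
have v10 : 0 <= (1 - v) * t ^+ 2 by apply: mulr_ge0; rewrite ?subr_ge0 ?sqr_ge0.
have A0 : 0 <= A by apply: mulr_ge0; rewrite ?subr_ge0.
have A1 : A <= x * t.
  have : A <= t ^+ 2 * r.
    by apply: ler_pM; rewrite ?subr_ge0 ?lerBlDl // ler_piMl ?sqr_ge0 //; lra.
  by move/le_trans; apply; rewrite expr2 -mulrA mulrC; apply: ler_wpM2r => //; lra.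
have t2v : 0 <= t ^+ 2 * v <= t ^+ 2.
  by rewrite mulr_ge0 ?sqr_ge0 ?ler_piMr ?sqr_ge0 // ltW.
have tv : 0 <= t * v <= t by rewrite mulr_ge0 ?ler_piMr //; lra.
have B0 : 0 <= B by apply: mulr_ge0 => //; move: t2v tv => /andP[? ?] /andP[? ?]; nra.
have B1 : B <= 35 * (x * t).
  have : B <= pi * (35 * t ^+ 2).
    by apply: ler_wpM2l => //; move: t2v tv => /andP[? ?] /andP[? ?]; nra.
  move/le_trans; apply; rewrite mulrCA; apply: ler_wpM2l => //; rewrite expr2 mulrA; apply: ler_wpM2r => //; lra.
by rewrite ler_norml; apply/andP; split; lra.
Qed.

Lemma second_moment_bound g (n := (2 * g + 1)%N) : (0 < g)%N ->
  `|second_moment F R g - 1 / 24 * (1 / zetaA2 F R) * qR F R ^+ n * n%:R ^+ 2|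
  <= (10 * qR F R + 3) * qR F R ^+ n * n%:R.
Proof.
move=> g0; rewrite second_momentE.
have e1 := @error_bound g (2 * g).+1 g0; have e2 := @error_bound g (2 * g) g0.
rewrite addn1 in e1 e2; have {}e1 := e1 (leqnn _); have {}e2 := e2 (leqnSn _).
have m := main_term_bound g; rewrite /n addn1 in m *.
move: e1 e2 m; rewrite mulrDr; rewrite !ler_norml.
move=> /andP[a1 a2] /andP[b1 b2] /andP[c1 c2]; apply/andP.
move: (qR F R ^+ _) ((2 * g).+1%:R) a1 a2 b1 b2 c1 c2 => x t.
split; lra.
Qed.

End Moment.

Theorem theorem2p5 (R : rcfType) (F : finFieldType) :
  odd #|F| -> (#|F| %% 4 = 1)%N ->
  exists C : R, exists g0 : nat, forall g : nat, (g0 <= g)%N ->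
    `| second_moment F R g
       - (1 / 24) * (1 / zetaA2 F R) * (qR F R) ^+ (2 * g + 1) * ((2 * g + 1)%:R) ^+ 2 |
    <= C * (qR F R) ^+ (2 * g + 1) * (2 * g + 1)%:R.
Proof.
(* 10 q is twice the 5 q of [error_bound], 3 comes from [main_term_bound], and g >= 1 is what
   [char_sum_bound] requires. *)
move=> oq q4; exists (10 * qR F R + 3), 1%N => g g0.
exact: second_moment_bound.
Qed.
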